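(* Let $q\in\mathbb{C}$, $q\neq0,\pm1$, let $\mathcal{A}=\mathcal{O}(GL_q(N))$ with fundamental corepresentation $\mathbf{u}=(u^i_j)_{i,j=1,\dots,N}$, and let $\hat R$ be the corresponding $R$-matrix and $\mathbf r$ the universal $r$-form of $\mathcal{A}$ with $\mathbf r(u^i_j,u^k_l)=\hat R^{ki}_{jl}$. Let $\Gamma_{\mathrm{bi}}$ be the bicovariant first order differential calculus (FODC) on $\mathcal{A}$ constructed from the bicovariant bimodule $(\mathbf{u}^c\otimes\mathbf{u},L^+\otimes L^{-,c})$, with differentiation $\mathrm{d}$ and left-invariant forms $\omega_{ij}:=\omega(u^i_j)=\sum_kS(u^i_k)\,\mathrm{d}u^k_j$. Let $\mathcal{Z}$ be the unital subalgebra of $\mathcal{A}$ generated by $x_i:=u^i_N$ and $y_i:=S(u^N_i)$, $i=1,\dots,N$. Then $\Gamma_{\mathrm{bi}}$ induces a left-covariant FODC $\Gamma^{\mathcal Z}=\mathcal{Z}\cdot\mathrm{d}\mathcal{Z}\cdot\mathcal{Z}$ on $\mathcal{Z}$ such that for all $i,j=1,\dots,N$: $$\mathrm{d}x_i\cdot x_j=q\sum_{k,m}\hat R^{ij}_{km}\,x_k\cdot\mathrm{d}x_m,$$ $$\mathrm{d}y_i\cdot y_j=q^{-1}\sum_{k,m}(\hat R^{-1})^{ji}_{mk}\,y_k\cdot\mathrm{d}y_m,$$ $$\mathrm{d}x_i\cdot y_j=q^{-1}\sum_{k,m}(\hat R^{-1})^{ki}_{mj}\,y_k\cdot\mathrm{d}x_m,$$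 $$\mathrm{d}y_i\cdot x_j=q\sum_{k,m}\grave R^{ij}_{km}\,x_k\cdot\mathrm{d}y_m,$$ where $\grave R^{ij}_{km}:=\mathbf r(S^2(u^k_j),u^i_m)$, $i,j,k,m=1,\dots,N$. Further, $\omega_{NN}x_i=q^2x_i\omega_{NN}$ and $\omega_{NN}y_i=q^{-2}y_i\omega_{NN}$ for $i=1,\dots,N$.
   Context: Hopf algebra notation: $\Delta,\varepsilon,S$ are comultiplication, counit, antipode; Sweedler notation $\Delta(a)=a_{(1)}\otimes a_{(2)}$. $\mathcal{A}^\circ$ is the Hopf dual, with antipode $S(f)(a)=f(S(a))$. $R$-matrix of $GL_q(N)$: $\hat R^{ij}_{kl}=q^{\delta_{ij}}\delta_{il}\delta_{jk}+(q-q^{-1})\theta(j-i)\delta_{ik}\delta_{jl}$, $i,j,k,l=1,\dots,N$, where $\theta(t)=1$ for $t>0$ and $\theta(t)=0$ for $t\le0$. $\mathcal{O}(GL_q(N))$ is the standard coordinate Hopf algebra: generated by $u^i_j$ and the inverse of the (central) quantum determinant, with relations $\sum_{k,l}\hat R^{ij}_{kl}u^k_mu^l_p=\sum_{k,l}u^i_ku^j_l\hat R^{kl}_{mp}$ and $\Delta(u^i_j)=\sum_ku^i_k\otimes u^k_j$, $\varepsilon(u^i_j)=\delta_{ij}$. Universal $r$-form: a linear functional $\mathbf r$ on $\mathcal{A}\otimes\mathcal{A}$ (write $\mathbf r(a,b)=\mathbf r(a\otimes b)$), invertible under convolution with inverse $\bar{\mathbf r}$, such that $\mathbf r(ab,c)=\mathbf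 r(a,c_{(1)})\mathbf r(b,c_{(2)})$, $\mathbf r(a,bc)=\mathbf r(a_{(1)},c)\mathbf r(a_{(2)},b)$, $\mathbf r(a_{(1)},b_{(1)})a_{(2)}b_{(2)}=\mathbf r(a_{(2)},b_{(2)})b_{(1)}a_{(1)}$. On $\mathcal{O}(GL_q(N))$ there is a unique one with $\mathbf r(u^i_j,u^k_l)=\hat R^{ki}_{jl}$. $L$-functionals: $l^{+i}_{\ \ j}(a)=\mathbf r(a,u^i_j)$, $l^{-i}_{\ \ j}(a)=\bar{\mathbf r}(u^i_j,a)$. A first order differential calculus (FODC) over an algebra $\mathcal{X}$ is an $\mathcal{X}$-bimodule $\Gamma$ with a linear map $\mathrm{d}:\mathcal{X}\to\Gamma$ such that $\mathrm{d}(xy)=x\cdot\mathrm{d}y+\mathrm{d}x\cdot y$ and $\Gamma$ is the linear span of elements $x\cdot\mathrm{d}y\cdot z$, $x,y,z\in\mathcal X$. If $\mathcal{X}\subseteq\mathcal{A}$ is a subalgebra with $\Delta(\mathcal{X})\subseteq\mathcal{A}\otimes\mathcal{X}$ (e.g. $\mathcal X=\mathcal A$), a FODC over $\mathcal{X}$ is left-covariant if there is a linear map $\Phi:\Gamma\to\mathcal{A}\otimes\Gamma$ with $\Phi(x\,\mathrm{d}y)=\Delta(x)(\mathrm{id}\otimes\mathrm{d})\Delta(y)$ for $x,y\in\mathcal{X}$; elements $\eta$ with $\Phi(\eta)=1\otimes\eta$ are left-invariant. For a FODC over $\mathcal{A}$, $\omega(a):=S(a_{(1)})\,\mathrm{d}a_{(2)}$.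 The calculus $\Gamma_{\mathrm{bi}}$: it is the known bicovariant (in particular left-covariant) FODC over $\mathcal{O}(GL_q(N))$, determined by the following two known properties, which are all that is needed of it: the forms $\omega_{ij}=\omega(u^i_j)$, $i,j=1,\dots,N$, are a vector space basis of the left-invariant one-forms (hence a free left $\mathcal{A}$-module basis of $\Gamma_{\mathrm{bi}}$), and for all $a\in\mathcal{A}$ $$\omega_{ij}\,a=\sum_{r,s}a_{(1)}\,l^{+i}_{\ \ r}(a_{(2)})\,S(l^{-s}_{\ \ j})(a_{(3)})\,\omega_{rs}.$$ *)

(* Defs.v *)
From HB Require Import structures.
From mathcomp Require Import all_boot all_order perm all_algebra.
From mathcomp Require Import boolp reals.
From mathcomp.real_closed Require Import complex.

Set Implicit Arguments.
Unset Strict Implicit.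
Unset Printing Implicit Defensive.

Import GRing.Theory.
Local Open Scope ring_scope.
Local Open Scope quotient_scope.

(* Tensor product of two K-vector spaces: formal sums of pairs, given as lists,
   two of which are identified iff no bilinear map distinguishes them. *)
Section Tensor.
Variables (K : fieldType) (V W : lmodType K).

Definition is_bilinear (U : lmodType K) (f : V -> W -> U) : Prop :=
  (forall w, linear (f ^~ w)) /\ (forall v, linear (f v)).

Definition pairsum (U : nmodType) (f : V -> W -> U) (s : seq (V * W)) : U :=
  \sum_(p <- s) f p.1 p.2.

Definition tensor_rel (s t : seq (V * W)) : bool :=
  `[< forall (U : lmodType K) (f : V -> W -> U),
        is_bilinear f -> pairsum f s = pairsum f t >].

Lemma tensor_rel_refl : reflexive tensor_rel.
Proof. by move=> s; apply/asboolP. Qed.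

Lemma tensor_rel_sym : symmetric tensor_rel.
Proof. by move=> s t; apply/asboolP/asboolP => h U f bf; rewrite h. Qed.

Lemma tensor_rel_trans : transitive tensor_rel.
Proof.
move=> t s u /asboolP h1 /asboolP h2; apply/asboolP => U f bf.
by rewrite h1 // h2.
Qed.

Canonical tensor_equiv :=
  EquivRel tensor_rel tensor_rel_refl tensor_rel_sym tensor_rel_trans.

Definition tensor := {eq_quot tensor_rel}.

HB.instance Definition _ := Choice.on tensor.
HB.instance Definition _ := EqQuotient.on tensor.

(* The value at t of the linear map on V (x) W induced by a bilinear map f;
   read as Sweedler notation, it is the sum of f v w over t = sum of v (x) w. *)
Definition tsum (U : nmodType) (f : V -> W -> U) (t : tensor) : U :=
  pairsum f (repr t).

Lemma tsum_pi (U : lmodType K) (f : V -> W -> U) s :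
  is_bilinear f -> tsum f (\pi_tensor s) = pairsum f s.
Proof.
move=> bf; rewrite /tsum; case: piP => t /eqmodP.
by move=> /asboolP h; rewrite -h.
Qed.

Lemma tensor_sep (t1 t2 : tensor) :
  (forall (U : lmodType K) (f : V -> W -> U), is_bilinear f ->
     tsum f t1 = tsum f t2) -> t1 = t2.
Proof.
move=> h; rewrite -[t1]reprK -[t2]reprK; apply/eqmodP/asboolP => U f bf.
exact: h.
Qed.

Definition tens_zero : tensor := \pi_tensor [::].
Definition tens_add (s t : tensor) : tensor := \pi_tensor (repr s ++ repr t).
Definition tens_scale (c : K) (s : tensor) : tensor :=
  \pi_tensor [seq (c *: p.1, p.2) | p <- repr s].
Definition tens_opp (s : tensor) : tensor := tens_scale (-1) s.

Lemma tsum0 (U : lmodType K) (f : V -> W -> U) :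
  is_bilinear f -> tsum f tens_zero = 0.
Proof. by move=> bf; rewrite tsum_pi // /pairsum big_nil. Qed.

Lemma tsumD (U : lmodType K) (f : V -> W -> U) s t :
  is_bilinear f -> tsum f (tens_add s t) = tsum f s + tsum f t.
Proof. by move=> bf; rewrite tsum_pi // /pairsum big_cat. Qed.

Lemma bilin0l (U : lmodType K) (f : V -> W -> U) w : is_bilinear f -> f 0 w = 0.
Proof.
case=> /(_ w) h _; have /= := h (-1) 0 0.
by rewrite scaler0 addr0 scaleN1r addNr.
Qed.

Lemma bilinZl (U : lmodType K) (f : V -> W -> U) c v w :
  is_bilinear f -> f (c *: v) w = c *: f v w.
Proof.
move=> bf; have := bf.1 w c v 0; rewrite /= addr0 => ->.
by rewrite (bilin0l w bf) addr0.
Qed.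

Lemma tsumZ (U : lmodType K) (f : V -> W -> U) c s :
  is_bilinear f -> tsum f (tens_scale c s) = c *: tsum f s.
Proof.
move=> bf; rewrite tsum_pi // /pairsum big_map scaler_sumr.
by apply: eq_bigr => p _ /=; rewrite bilinZl.
Qed.

Lemma tens_addA : associative tens_add.
Proof.
by move=> s t u; apply: tensor_sep => U f bf; rewrite !tsumD // addrA.
Qed.

Lemma tens_addC : commutative tens_add.
Proof. by move=> s t; apply: tensor_sep => U f bf; rewrite !tsumD // addrC. Qed.

Lemma tens_add0 : left_id tens_zero tens_add.
Proof. by move=> s; apply: tensor_sep => U f bf; rewrite tsumD // tsum0 // add0r. Qed.

Lemma tens_addN : left_inverse tens_zero tens_opp tens_add.
Proof.
move=> s; apply: tensor_sep => U f bf; rewrite tsumD // tsumZ // tsum0 //.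
by rewrite scaleN1r addNr.
Qed.

HB.instance Definition _ :=
  GRing.isZmodule.Build tensor tens_addA tens_addC tens_add0 tens_addN.

Lemma tens_scaleA a b s : tens_scale a (tens_scale b s) = tens_scale (a * b) s.
Proof. by apply: tensor_sep => U f bf; rewrite !tsumZ // scalerA. Qed.

Lemma tens_scale1 : left_id 1 tens_scale.
Proof. by move=> s; apply: tensor_sep => U f bf; rewrite tsumZ // scale1r. Qed.

Lemma tens_scaleDr : right_distributive tens_scale +%R.
Proof.
move=> c s t; apply: tensor_sep => U f bf.
by rewrite tsumZ // !tsumD // !tsumZ // scalerDr.
Qed.

Lemma tens_scaleDl s : {morph tens_scale^~ s : a b / a + b}.
Proof.
move=> a b; apply: tensor_sep => U f bf.
by rewrite tsumZ // tsumD // !tsumZ // scalerDl.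
Qed.

HB.instance Definition _ := GRing.Zmodule_isLmodule.Build K tensor
  tens_scaleA tens_scale1 tens_scaleDr tens_scaleDl.

Definition tpure (v : V) (w : W) : tensor := \pi_tensor [:: (v, w)].

Lemma tsum_pure (U : lmodType K) (f : V -> W -> U) v w :
  is_bilinear f -> tsum f (tpure v w) = f v w.
Proof. by move=> bf; rewrite tsum_pi // /pairsum big_seq1. Qed.

Lemma tsum_linear (U : lmodType K) (f : V -> W -> U) :
  is_bilinear f -> linear (tsum f).
Proof. by move=> bf c s t; rewrite tsumD // tsumZ. Qed.

Lemma tpure_bilinear : is_bilinear tpure.
Proof.
split=> [w c v v'|v c w w']; apply: tensor_sep => U f bf /=;
  rewrite tsum_linear // !tsum_pure //; [exact: bf.1|exact: bf.2].
Qed.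

Lemma tensor_pureE (t : tensor) : t = \sum_(p <- repr t) tpure p.1 p.2.
Proof.
apply: tensor_sep => U f bf; rewrite {1}/tsum /pairsum.
elim: (repr t) => [|p s IHs]; first by rewrite !big_nil (tsum0 bf).
by rewrite !big_cons (tsumD _ _ bf) tsum_pure // IHs.
Qed.

End Tensor.

Arguments tpure {K V W} v w.
Arguments tsum {K V W U} f t.

Notation "v ⊗ w" := (tpure v w) (at level 40, left associativity) : ring_scope.

Definition tmap (K : fieldType) (V W V' W' : lmodType K)
    (f : V -> V') (g : W -> W') (t : tensor V W) : tensor V' W' :=
  tsum (fun v w => f v ⊗ g w) t.

(* (a (x) x) (b (x) y) = m1 a b (x) m2 x y, extended bilinearly. *)
Definition tmul (K : fieldType) (V1 V2 V W1 W2 W : lmodType K)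
    (m1 : V1 -> V2 -> V) (m2 : W1 -> W2 -> W)
    (s : tensor V1 W1) (t : tensor V2 W2) : tensor V W :=
  tsum (fun a x => tsum (fun b y => m1 a b ⊗ m2 x y) t) s.

HB.mixin Record isHopf (K : fieldType) A & GRing.Algebra K A := {
  comul : {linear A -> tensor A A};
  counit : {scalar A};
  antipode : {linear A -> A};
  comulA : forall a : A,
    tsum (fun a1 a2 => tsum (fun b1 b2 => b1 ⊗ (b2 ⊗ a2)) (comul a1)) (comul a)
    = tsum (fun a1 a2 => a1 ⊗ comul a2) (comul a);
  counitl : forall a : A, tsum (fun a1 a2 => counit a1 *: a2) (comul a) = a;
  counitr : forall a : A, tsum (fun a1 a2 => counit a2 *: a1) (comul a) = a;
  comul1 : comul 1 = 1 ⊗ 1;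
  comulM : forall a b : A, comul (a * b) = tmul *%R *%R (comul a) (comul b);
  counit1 : counit 1 = 1;
  counitM : forall a b : A, counit (a * b) = counit a * counit b;
  antipodel : forall a : A,
    tsum (fun a1 a2 => antipode a1 * a2) (comul a) = counit a *: 1;
  antipoder : forall a : A,
    tsum (fun a1 a2 => a1 * antipode a2) (comul a) = counit a *: 1
}.

#[short(type="hopfType")]
HB.structure Definition Hopf (K : fieldType) :=
  {A of GRing.Algebra K A & isHopf K A}.

Section RMatrix.
Variables (K : fieldType) (N : nat) (q : K).
Implicit Types i j k l m p : 'I_N.

(* [Rhat i j k l] has upper indices i, j and lower indices k, l. *)
Definition Rhat i j k l : K :=
  q ^+ (i == j) *+ ((i == l) && (j == k))
  + (q - q^-1) *+ [&& (i < j)%N, i == k & j == l].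

Definition Rhat_mx : 'M[K]_#|{: 'I_N * 'I_N}| :=
  \matrix_(a, b) Rhat (enum_val a).1 (enum_val a).2 (enum_val b).1 (enum_val b).2.

Definition Rhat_inv i j k l : K :=
  invmx Rhat_mx (enum_rank (i, j)) (enum_rank (k, l)).

Definition RTT (A : algType K) (u : 'M[A]_N) : Prop :=
  forall i j m p,
    \sum_k \sum_l Rhat i j k l *: (u k m * u l p)
    = \sum_k \sum_l Rhat k l m p *: (u i k * u j l).

Definition perm_length (s : 'S_N) : nat :=
  #|[set x : 'I_N * 'I_N | (x.1 < x.2)%N && (s x.2 < s x.1)%N]|.

Definition qdet (A : algType K) (u : 'M[A]_N) : A :=
  \sum_(s : 'S_N) (- q) ^+ perm_length s *: \prod_(i < N) u i (s i).

Definition two_sided_inverse (A : algType K) (a b : A) : Prop :=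
  a * b = 1 /\ b * a = 1.

(* A is presented by the entries of u and an inverse D of the quantum
   determinant, subject to the RTT relations. *)
Definition OGLq_presentation (A : algType K) (u : 'M[A]_N) : Prop :=
  [/\ RTT u, (exists D, two_sided_inverse (qdet u) D) &
    forall (B : algType K) (v : 'M[B]_N), RTT v ->
      (exists D, two_sided_inverse (qdet v) D) ->
      (exists f : {lrmorphism A -> B}, forall i j, f (u i j) = v i j)
      /\ (forall f g : {lrmorphism A -> B},
            (forall i j, f (u i j) = g (u i j)) -> f =1 g)].

Definition is_OGLq (A : hopfType K) (u : 'M[A]_N) : Prop :=
  [/\ OGLq_presentation u,
      (forall i j, comul (u i j) = \sum_k u i k ⊗ u k j) &
      (forall i j, counit (u i j) = (i == j)%:R)].

End RMatrix.

Section RForm.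
Variables (K : fieldType) (A : hopfType K).

Definition convolution (f g : tensor A A -> K) (a b : A) : K :=
  tsum (fun a1 a2 => tsum (fun b1 b2 => f (a1 ⊗ b1) * g (a2 ⊗ b2)) (comul b))
    (comul a).

Record universal_rform (r rbar : {scalar tensor A A}) : Prop := {
  rform_convr : forall a b, convolution r rbar a b = counit a * counit b;
  rform_convl : forall a b, convolution rbar r a b = counit a * counit b;
  rform_mull : forall a b c,
    r ((a * b) ⊗ c) = tsum (fun c1 c2 => r (a ⊗ c1) * r (b ⊗ c2)) (comul c);
  rform_mulr : forall a b c,
    r (a ⊗ (b * c)) = tsum (fun a1 a2 => r (a1 ⊗ c) * r (a2 ⊗ b)) (comul a);
  rform_braid : forall a b,
    tsum (fun a1 a2 => tsum (fun b1 b2 =>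
      r (a1 ⊗ b1) *: (a2 * b2)) (comul b)) (comul a)
    = tsum (fun a1 a2 => tsum (fun b1 b2 =>
      r (a2 ⊗ b2) *: (b1 * a1)) (comul b)) (comul a)
}.

Variables (N : nat) (u : 'M[A]_N) (r rbar : {scalar tensor A A}).

Definition lplus (i j : 'I_N) (a : A) : K := r (a ⊗ u i j).
Definition lminus (i j : 'I_N) (a : A) : K := rbar (u i j ⊗ a).

Definition dual_antipode (f : A -> K) (a : A) : K := f (antipode a).

End RForm.

Record bimodule (K : fieldType) (X : algType K) := Bimodule {
  bimod_car :> lmodType K;
  lact : X -> bimod_car -> bimod_car;
  ract : bimod_car -> X -> bimod_car;
  lact_bilinear : is_bilinear lact;
  ract_bilinear : is_bilinear ract;
  lact1 : forall g, lact 1 g = g;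
  lactM : forall x y g, lact (x * y) g = lact x (lact y g);
  ract1 : forall g, ract g 1 = g;
  ractM : forall x y g, ract g (x * y) = ract (ract g x) y;
  lractA : forall x g y, ract (lact x g) y = lact x (ract g y)
}.

Arguments lact {K X b} x g.
Arguments ract {K X b} g x.

Notation "x *> g" := (lact x g) (at level 40, left associativity) : ring_scope.
Notation "g <* x" := (ract g x) (at level 40, left associativity) : ring_scope.

Record fodc (K : fieldType) (X : algType K) := Fodc {
  fodc_bimod :> bimodule X;
  diff : {linear X -> fodc_bimod};
  diffM : forall x y, diff (x * y) = x *> diff y + diff x <* y;
  fodc_span : forall g : fodc_bimod, exists s : seq (X * X * X),
    g = \sum_(t <- s) t.1.1 *> diff t.1.2 <* t.2
}.

Arguments diff {K X} f : rename.

(* The unital subalgebra of A generated by the elements satisfying S. *)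
Section Subalgebra.
Variables (K : fieldType) (A : algType K) (S : A -> Prop).

Inductive generated : A -> Prop :=
| gen_base a of S a : generated a
| gen_one : generated 1
| gen_lin c a b of generated a & generated b : generated (c *: a + b)
| gen_mul a b of generated a & generated b : generated (a * b).

Definition generatedb : pred A := fun a => `[< generated a >].

Lemma generatedb_closed : GRing.subalg_closed generatedb.
Proof.
split=> [|c a b /asboolP ha /asboolP hb|a b /asboolP ha /asboolP hb];
  apply/asboolP; [exact: gen_one|exact: gen_lin|exact: gen_mul].
Qed.

HB.instance Definition _ := GRing.isSubalgClosed.Build K A generatedb
  generatedb_closed.

Record subalg := Subalg {
  subalg_val : A;
  subalg_valP : subalg_val \in generatedb
}.

HB.instance Definition _ := [isSub for subalg_val].
HB.instance Definition _ := [Choice of subalg by <:].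
HB.instance Definition _ := [SubChoice_isSubAlgebra of subalg by <:].

Fact subalg_val_linear : linear subalg_val.
Proof. exact: (linearP (\val : {linear subalg -> A})). Qed.

Fact subalg_val_monoid_morphism : monoid_morphism subalg_val.
Proof.
by split; [exact: (rmorph1 (\val : {rmorphism subalg -> A}))
          |exact: (rmorphM (\val : {rmorphism subalg -> A}))].
Qed.

HB.instance Definition _ := GRing.isLinear.Build K subalg A *:%R subalg_val
  subalg_val_linear.
HB.instance Definition _ := GRing.isMonoidMorphism.Build subalg A subalg_val
  subalg_val_monoid_morphism.

Definition subalg_gen (a : A) (Sa : S a) : subalg :=
  Subalg (introT (asboolP (generated a)) (gen_base Sa)).

End Subalgebra.

(* The calculus X . dX . X over X induced by a calculus over A, along a
   homomorphism iota : X -> A (for us, the inclusion of a subalgebra). *)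
Section Induced.
Variables (K : fieldType) (A X : algType K) (iota : {lrmorphism X -> A}).
Variable Gam : fodc A.

Definition in_induced : pred Gam := fun g =>
  `[< exists s : seq (X * X * X),
        g = \sum_(t <- s) iota t.1.1 *> diff Gam (iota t.1.2) <* iota t.2 >].

Lemma lactDr a (g h : Gam) : a *> (g + h) = a *> g + a *> h.
Proof. by have := (lact_bilinear Gam).2 a 1 g h; rewrite !scale1r. Qed.
Lemma ractDl a (g h : Gam) : (g + h) <* a = g <* a + h <* a.
Proof. by have := (ract_bilinear Gam).1 a 1 g h; rewrite !scale1r. Qed.
Lemma lact0r a : a *> (0 : Gam) = 0.
Proof. by apply: (addrI (a *> (0 : Gam))); rewrite -lactDr !addr0. Qed.
Lemma ract0l a : (0 : Gam) <* a = 0.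
Proof. by apply: (addrI ((0 : Gam) <* a)); rewrite -ractDl !addr0. Qed.
Lemma lactZl c a (g : Gam) : (c *: a) *> g = c *: (a *> g).
Proof. exact: (bilinZl c a g (lact_bilinear Gam)). Qed.
Lemma lact_sum a s (F : X * X * X -> Gam) :
  a *> (\sum_(t <- s) F t) = \sum_(t <- s) (a *> F t).
Proof. by apply: (big_morph _ (lactDr a) (lact0r a)). Qed.
Lemma ract_sum a s (F : X * X * X -> Gam) :
  (\sum_(t <- s) F t) <* a = \sum_(t <- s) (F t <* a).
Proof. by apply: (big_morph (fun g => g <* a) (ractDl a) (ract0l a)). Qed.

Lemma in_induced_submod : GRing.submod_closed in_induced.
Proof.
split=> [|c g h /asboolP[s ->] /asboolP[t ->]]; apply/asboolP.
  by exists [::]; rewrite big_nil.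
exists ([seq (c *: p.1.1, p.1.2, p.2) | p <- s] ++ t).
rewrite big_cat big_map /= scaler_sumr; congr (_ + _).
apply: eq_bigr => p _; rewrite linearZ /= lactZl.
by rewrite (bilinZl _ _ _ (ract_bilinear Gam)).
Qed.

HB.instance Definition _ := GRing.isSubmodClosed.Build K Gam in_induced
  in_induced_submod.

Record induced_car := InducedCar {
  induced_val : Gam;
  induced_valP : induced_val \in in_induced
}.

HB.instance Definition _ := [isSub for induced_val].
HB.instance Definition _ := [Choice of induced_car by <:].
HB.instance Definition _ := [SubChoice_isSubLmodule of induced_car by <:].

Lemma in_induced_lact x g : g \in in_induced -> (iota x *> g) \in in_induced.
Proof.
move=> /asboolP[s ->]; apply/asboolP.
exists [seq (x * p.1.1, p.1.2, p.2) | p <- s].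
rewrite big_map lact_sum; apply: eq_bigr => p _ /=.
by rewrite rmorphM !lractA lactM.
Qed.

Lemma in_induced_ract x g : g \in in_induced -> (g <* iota x) \in in_induced.
Proof.
move=> /asboolP[s ->]; apply/asboolP.
exists [seq (p.1.1, p.1.2, p.2 * x) | p <- s].
rewrite big_map ract_sum; apply: eq_bigr => p _ /=.
by rewrite rmorphM ractM.
Qed.

Lemma in_induced_diff x : diff Gam (iota x) \in in_induced.
Proof.
apply/asboolP; exists [:: (1, x, 1)].
by rewrite big_seq1 /= rmorph1 lact1 ract1.
Qed.

Definition induced_lact (x : X) (g : induced_car) : induced_car :=
  InducedCar (in_induced_lact x (induced_valP g)).
Definition induced_ract (g : induced_car) (x : X) : induced_car :=
  InducedCar (in_induced_ract x (induced_valP g)).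
Definition induced_d (x : X) : induced_car := InducedCar (in_induced_diff x).

Fact induced_lact_bilinear : is_bilinear induced_lact.
Proof.
split=> [g c x y|x c g h]; apply: val_inj; rewrite /=.
  by rewrite linearP; exact: (lact_bilinear Gam).1.
exact: (lact_bilinear Gam).2.
Qed.

Fact induced_ract_bilinear : is_bilinear induced_ract.
Proof.
split=> [x c g h|g c x y]; apply: val_inj; rewrite /=.
  exact: (ract_bilinear Gam).1.
by rewrite linearP; exact: (ract_bilinear Gam).2.
Qed.

Definition induced_bimodule : bimodule X.
Proof.
refine (@Bimodule K X induced_car induced_lact induced_ract
  induced_lact_bilinear induced_ract_bilinear _ _ _ _ _).
- by move=> g; apply: val_inj; rewrite /= rmorph1 lact1.
- by move=> x y g; apply: val_inj; rewrite /= rmorphM lactM.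
- by move=> g; apply: val_inj; rewrite /= rmorph1 ract1.
- by move=> x y g; apply: val_inj; rewrite /= rmorphM ractM.
- by move=> x g y; apply: val_inj; rewrite /= lractA.
Defined.

Fact induced_d_linear : linear induced_d.
Proof.
by move=> c x y; apply: val_inj; rewrite /= !linearP.
Qed.

HB.instance Definition _ := GRing.isLinear.Build K X induced_car *:%R induced_d
  induced_d_linear.

Definition induced_fodc : fodc X.
Proof.
refine (@Fodc K X induced_bimodule induced_d _ _).
- move=> x y; apply: val_inj; rewrite raddfD /=.
  by rewrite rmorphM diffM.
- move=> [g Pg]; have /asboolP[s gE] := Pg; exists s.
  apply: val_inj; rewrite raddf_sum /= gE.
  by apply: eq_bigr.
Defined.

End Induced.

Section Covariance.
Variables (K : fieldType) (A : hopfType K).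

(* Here X is a subalgebra of A via iota, and (id (x) iota) embeds A (x) X in
   A (x) A: tx and ty are Delta x and Delta y, as elements of A (x) X. *)
Definition left_coideal (X : algType K) (iota : {lrmorphism X -> A}) : Prop :=
  forall x : X, exists tx : tensor A X, tmap id iota tx = comul (iota x).

Definition left_coaction (X : algType K) (iota : {lrmorphism X -> A})
    (Gam : fodc X) (Phi : {linear Gam -> tensor A Gam}) : Prop :=
  forall (x y : X) (tx ty : tensor A X),
    tmap id iota tx = comul (iota x) -> tmap id iota ty = comul (iota y) ->
    Phi (x *> diff Gam y) = tmul *%R lact tx (tmap id (diff Gam) ty).

Definition left_covariant (X : algType K) (iota : {lrmorphism X -> A})
    (Gam : fodc X) : Prop :=
  left_coideal iota
  /\ exists Phi : {linear Gam -> tensor A Gam}, left_coaction iota Phi.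

Variable Gam : fodc A.

Definition right_covariant : Prop :=
  exists Psi : {linear Gam -> tensor Gam A}, forall x y : A,
    Psi (x *> diff Gam y)
    = tmul lact *%R (comul x) (tmap (diff Gam) id (comul y)).

Definition left_invariant (Phi : {linear Gam -> tensor A Gam}) (g : Gam) : Prop :=
  Phi g = 1 ⊗ g.

Definition omega (a : A) : Gam :=
  tsum (fun a1 a2 => antipode a1 *> diff Gam a2) (comul a).

End Covariance.

Arguments omega {K A} Gam a.

(* The calculus Gamma_bi, through its two characteristic properties. *)
Section GammaBi.
Variables (K : fieldType) (A : hopfType K) (N : nat) (u : 'M[A]_N).
Variables (r rbar : {scalar tensor A A}).

Definition omega_basis (Gam : fodc A) (Phi : {linear Gam -> tensor A Gam}) : Prop :=
  [/\ forall i j, left_invariant Phi (omega Gam (u i j)),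
      forall g, left_invariant Phi g -> exists c : 'I_N -> 'I_N -> K,
        g = \sum_i \sum_j c i j *: omega Gam (u i j) &
      forall c : 'I_N -> 'I_N -> K,
        \sum_i \sum_j c i j *: omega Gam (u i j) = 0 -> forall i j, c i j = 0].

Definition omega_commutation (Gam : fodc A) : Prop :=
  forall (i j : 'I_N) (a : A),
    omega Gam (u i j) <* a
    = \sum_s \sum_t
        tsum (fun a1 a' => tsum (fun a2 a3 =>
            (lplus u r i s a2 * dual_antipode (lminus u rbar t j) a3)
              *: (a1 *> omega Gam (u s t)))
          (comul a')) (comul a).

Definition is_Gamma_bi (Gam : fodc A) : Prop :=
  [/\ exists2 Phi : {linear Gam -> tensor A Gam},
        left_coaction (idfun : {lrmorphism A -> A}) Phi & omega_basis Phi,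
      right_covariant Gam &
      omega_commutation Gam].

End GammaBi.

(* The subalgebra Z; the last index N is [ord_max : 'I_n.+1]. *)
Section SubalgebraZ.
Variables (K : fieldType) (A : hopfType K) (n : nat) (u : 'M[A]_n.+1).

Definition Zgenerator (a : A) : Prop :=
  exists i : 'I_n.+1, a = u i ord_max \/ a = antipode (u ord_max i).

Definition Zalg : algType K := subalg Zgenerator.

Definition Zx (i : 'I_n.+1) : Zalg :=
  subalg_gen (ex_intro _ i (or_introl erefl) : Zgenerator (u i ord_max)).

Definition Zy (i : 'I_n.+1) : Zalg :=
  subalg_gen
    (ex_intro _ i (or_intror erefl) : Zgenerator (antipode (u ord_max i))).

Definition Zincl : {lrmorphism Zalg -> A} := @subalg_val K A Zgenerator.

Definition GammaZ (Gam : fodc A) : fodc Zalg := induced_fodc Zincl Gam.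

End SubalgebraZ.

(* Main.v *)
Require Import Defs.
From HB Require Import structures.
From mathcomp Require Import all_boot all_order perm all_algebra ring.
From mathcomp Require Import boolp reals classical_sets.
From mathcomp.real_closed Require Import complex.

(* The commutation rule of Gamma_bi is evaluated on the coefficients of the
   corepresentation u and of its contragredient, so that everything reduces to
   the values of r on u, S(u) and S^2(u). Since r(S(u), u) is the convolution
   inverse, it is R^-1; the values r(u, S(u)) and r(S^2(u), u) solve triangular
   linear systems, which determine them on the last row and give the quantum
   trace of the former. Triangularity of R then collapses the commutation rule
   of omega_kN with x_j, y_j and of omega_Nk with x_j, y_j to short sums.
   Expanding dx_i = sum_k u^i_k omega_kN and dy_i = - sum_p omega_Np S(u^p_i),
   the relations follow from the braid relations between u and S(u).
   For left covariance, the inclusion of the induced calculus into Gamma_bi has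
   a linear retraction p (Zorn), and (id (x) p) o Phi restricts to the
   coaction. *)

Set Implicit Arguments.
Unset Strict Implicit.
Unset Printing Implicit Defensive.

Import GRing.Theory.
Local Open Scope ring_scope.

(** * Linear maps on tensor products *)

Section LinearMaps.
Variables (K : fieldType).
Implicit Types V W U : lmodType K.

(** Linearity is the bare predicate here, so that a bilinear map with one argument fixed qualifies
    without being packed as a morphism. *)
Lemma lin_sum V U (F : V -> U) I (s : seq I) (P : pred I) (x : I -> V) :
  linear F -> F (\sum_(i <- s | P i) x i) = \sum_(i <- s | P i) F (x i).
Proof.
move=> lF; apply: (big_morph F) => [a b|].
  by have := lF 1 a b; rewrite !scale1r.
by have := lF (-1) 0 0; rewrite scaler0 addr0 scaleN1r addNr.
Qed.

Lemma linZ V U (F : V -> U) c x : linear F -> F (c *: x) = c *: F x.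
Proof.
move=> lF; have F0 : F 0 = 0.
  by have := lF (-1) 0 0; rewrite scaler0 addr0 scaleN1r addNr.
by have := lF c x 0; rewrite F0 !addr0.
Qed.

Lemma tsum_sum V W U (f : V -> W -> U) I (s : seq I) (P : pred I) v w :
  is_bilinear f ->
  tsum f (\sum_(i <- s | P i) v i ⊗ w i) = \sum_(i <- s | P i) f (v i) (w i).
Proof.
move=> bf; rewrite (lin_sum _ _ _ (tsum_linear bf)).
by apply: eq_bigr => i _; rewrite tsum_pure.
Qed.

Lemma eq_tsum V W (U : nmodType) (f g : V -> W -> U) t :
  f =2 g -> tsum f t = tsum g t.
Proof. by move=> fg; apply: eq_bigr => p _; rewrite fg. Qed.

Lemma tensor_ext V W U (F G : tensor V W -> U) :
  linear F -> linear G -> (forall v w, F (v ⊗ w) = G (v ⊗ w)) -> F =1 G.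
Proof.
move=> lF lG FG t; rewrite (tensor_pureE t) (lin_sum _ _ _ lF) (lin_sum _ _ _ lG).
by apply: eq_bigr.
Qed.

Lemma bilinear_comp V W (V' W' : lmodType K) U (B : V' -> W' -> U)
    (f : V -> V') (g : W -> W') :
  is_bilinear B -> linear f -> linear g ->
  is_bilinear (fun v w => B (f v) (g w)).
Proof.
move=> [B1 B2] lf lg; split=> [w c x y|v c x y]; first by rewrite lf B1.
by rewrite lg B2.
Qed.

Lemma bilinear_scale V W U (f : V -> K) (g : W -> U) :
  linear (f : V -> K^o) -> linear g -> is_bilinear (fun v w => f v *: g w).
Proof.
move=> lf lg; split=> [w c x y|v c x y]; first by rewrite lf scalerDl scalerA.
by rewrite lg scalerDr !scalerA mulrC.
Qed.

Lemma bilinear_mul V W (f : V -> K) (g : W -> K) :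
  linear (f : V -> K^o) -> linear (g : W -> K^o) ->
  is_bilinear ((fun v w => f v * g w) : V -> W -> K^o).
Proof. exact: (@bilinear_scale V W K^o). Qed.

Lemma bilinear_sum V W U (I : finType) (F : I -> V -> W -> U) :
  (forall i, is_bilinear (F i)) -> is_bilinear (fun v w => \sum_i F i v w).
Proof.
move=> bF; split=> [w c x y|v c x y]; rewrite scaler_sumr -big_split;
  apply: eq_bigr => i _; [exact: (bF i).1|exact: (bF i).2].
Qed.

End LinearMaps.

Section TensorMaps.
Variables (K : fieldType).

Lemma tmap_pure (V W V' W' : lmodType K) (f : V -> V') (g : W -> W') v w :
  linear f -> linear g -> tmap f g (v ⊗ w) = f v ⊗ g w.
Proof.
move=> lf lg; rewrite /tmap tsum_pure //.
exact: bilinear_comp (tpure_bilinear _ _) lf lg.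
Qed.

Lemma tmap_linear (V W V' W' : lmodType K) (f : V -> V') (g : W -> W') :
  linear f -> linear g -> linear (tmap f g).
Proof.
move=> lf lg; apply: tsum_linear.
exact: bilinear_comp (tpure_bilinear _ _) lf lg.
Qed.

Variables (V1 V2 V W1 W2 W : lmodType K).
Variables (m1 : V1 -> V2 -> V) (m2 : W1 -> W2 -> W).
Hypotheses (bm1 : is_bilinear m1) (bm2 : is_bilinear m2).

Fact tmul_inner a x : is_bilinear (fun b y => m1 a b ⊗ m2 x y).
Proof.
exact: bilinear_comp (tpure_bilinear _ _) (bm1.2 a) (bm2.2 x).
Qed.

Fact tmul_outer t :
  is_bilinear (fun a x => tsum (fun b y => m1 a b ⊗ m2 x y) t).
Proof.
have [p1 p2] := tpure_bilinear V W.
split=> [w c x y|v c x y] /=; rewrite /tsum /pairsum scaler_sumr -big_split;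
  apply: eq_bigr => p _ /=; first by rewrite bm1.1 p1.
by rewrite bm2.1 p2.
Qed.

(** Since [tmul] is a nested sum, linearity in the second factor is checked term by term over a
    fixed representative of the first. *)
Lemma tmul_bilinear : is_bilinear (tmul m1 m2).
Proof.
split=> [t|s]; first exact: tsum_linear (tmul_outer t).
have E t : tmul m1 m2 s t =
    \sum_(p <- repr s) tsum (fun b y => m1 p.1 b ⊗ m2 p.2 y) t by [].
move=> c t t'; rewrite !E scaler_sumr -big_split.
by apply: eq_bigr => p _; rewrite (tsum_linear (tmul_inner _ _)).
Qed.

Lemma tmul_pure a x b y : tmul m1 m2 (a ⊗ x) (b ⊗ y) = m1 a b ⊗ m2 x y.
Proof.
by rewrite /tmul tsum_pure ?tsum_pure //;
  [exact: tmul_inner | exact: tmul_outer].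
Qed.

End TensorMaps.

Lemma mul_bilinear (K : fieldType) (A : algType K) :
  is_bilinear (@GRing.mul A : A -> A -> A).
Proof.
by split=> [w c x y|v c x y]; rewrite ?mulrDl ?mulrDr -?scalerAl -?scalerAr.
Qed.
#[local] Hint Extern 0 (is_bilinear _) => exact: mul_bilinear : core.

(** * Matrix corepresentations and their contragredients *)

Section Corepresentations.
Variables (K : fieldType) (A : hopfType K).

Lemma tmulA (s t w : tensor A A) :
  tmul *%R *%R (tmul *%R *%R s t) w = tmul *%R *%R s (tmul *%R *%R t w).
Proof.
have [m1 m2] := tmul_bilinear (mul_bilinear A) (mul_bilinear A).
move: s; apply: tensor_ext => [c x y|c x y|a a']; rewrite ?m1 //.
move: t; apply: tensor_ext => [c x y|c x y|b b']; rewrite ?m2 ?m1 ?m2 //.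
move: w; apply: tensor_ext => [c x y|c x y|d d']; rewrite ?m2 //.
by rewrite !tmul_pure // !mulrA.
Qed.

Lemma tmul1l (t : tensor A A) : tmul *%R *%R (1 ⊗ 1) t = t.
Proof.
have [m1 m2] := tmul_bilinear (mul_bilinear A) (mul_bilinear A).
move: t; apply: tensor_ext => [||a b] //.
by rewrite tmul_pure // !mul1r.
Qed.

Lemma tmul1r (t : tensor A A) : tmul *%R *%R t (1 ⊗ 1) = t.
Proof.
have [m1 m2] := tmul_bilinear (mul_bilinear A) (mul_bilinear A).
move: t; apply: tensor_ext => [||a b] //.
by rewrite tmul_pure // !mulr1.
Qed.

Variable n : nat.
Implicit Type v : 'M[A]_n.

Definition corep v : Prop :=
  (forall i j, comul (v i j) = \sum_k v i k ⊗ v k j)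
  /\ (forall i j, counit (v i j) = (i == j)%:R).

(** The transpose makes up for the antipode reversing the coproduct. *)
Definition contragredient v : 'M[A]_n := \matrix_(i, j) antipode (v j i).

Lemma contraE v i j : contragredient v i j = antipode (v j i).
Proof. by rewrite mxE. Qed.

Lemma corep_antipodel v i j : corep v ->
  \sum_k antipode (v i k) * v k j = (i == j)%:R.
Proof.
move=> [cv ev]; have := antipodel (v i j); rewrite cv ev scaler_nat tsum_sum //.
exact: bilinear_comp (mul_bilinear A) (linearP _) (fun _ _ _ => erefl).
Qed.

Lemma corep_antipoder v i j : corep v ->
  \sum_k v i k * antipode (v k j) = (i == j)%:R.
Proof.
move=> [cv ev]; have := antipoder (v i j); rewrite cv ev scaler_nat tsum_sum //.
exact: bilinear_comp (mul_bilinear A) (fun _ _ _ => erefl) (linearP _).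
Qed.

Lemma sum_delta (U : lmodType K) (F : 'I_n -> U) i :
  \sum_k (k == i)%:R *: F k = F i.
Proof.
rewrite (bigD1 i) //= eqxx scale1r big1 ?addr0 // => k /negbTE ->.
by rewrite scale0r.
Qed.

(** Uniqueness of inverses for matrices over the tensor square of [A]: the coproducts of S(v) form a
    left inverse of the matrix of coproducts of v, because [comul] is multiplicative, and [T],
    transposed, is a right inverse. *)
Lemma corep_contragredient v : corep v -> corep (contragredient v).
Proof.
move=> cv; have [dv ev] := cv.
have [m1 m2] := tmul_bilinear (mul_bilinear A) (mul_bilinear A).
have [p1 p2] := tpure_bilinear A A.
pose T i j : tensor A A := \sum_k contragredient v i k ⊗ contragredient v k j.
have vT i j : \sum_k tmul *%R *%R (comul (v i k)) (T j k) = (i == j)%:R *: (1 ⊗ 1).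
  transitivity (\sum_k \sum_a \sum_b
     (v i a * antipode (v b j)) ⊗ (v a k * antipode (v k b))).
    apply: eq_bigr => k _; rewrite dv (lin_sum _ _ _ (m1 _)).
    apply: eq_bigr => a _; rewrite /T (lin_sum _ _ _ (m2 _)).
    by apply: eq_bigr => b _; rewrite tmul_pure // !contraE.
  rewrite exchange_big; under eq_bigr do rewrite exchange_big.
  transitivity (\sum_a (v i a * antipode (v a j)) ⊗ (1 : A)).
    apply: eq_bigr => a _.
    rewrite -[RHS](sum_delta (fun b => (v i a * antipode (v b j)) ⊗ (1 : A))).
    apply: eq_bigr => b _; rewrite -(lin_sum _ _ _ (p2 _)) corep_antipoder //.
    by rewrite -scaler_nat (linZ _ _ (p2 _)) eq_sym.
  rewrite -(lin_sum _ _ _ (p1 1)) corep_antipoder //.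
  by rewrite -scaler_nat (linZ _ _ (p1 1)).
split=> i j; last first.
  rewrite contraE; have: counit (\sum_k antipode (v j k) * v k i) = (j == i)%:R :> K.
    rewrite corep_antipodel // -[X in counit X]scaler_nat linearZ /= counit1.
    by rewrite mulr1.
  rewrite linear_sum (bigD1 i) //= counitM ev eqxx mulr1 big1 ?addr0.
    by rewrite eq_sym.
  by move=> k ki; rewrite counitM ev (negbTE ki) mulr0.
(* The product Delta(S(v)) Delta(v) T is inserted; it collapses to Delta(S(v)) when bracketed on the
   right and to T when bracketed on the left. *)
transitivity (\sum_k \sum_l tmul *%R *%R
    (tmul *%R *%R (comul (antipode (v j k))) (comul (v k l))) (T i l)).
  transitivity (\sum_k tmul *%R *%R (comul (antipode (v j k)))
      ((k == i)%:R *: (1 ⊗ 1))); last first.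
    apply: eq_bigr => k _; rewrite -vT (lin_sum _ _ _ (m2 _)).
    by apply: eq_bigr => l _; rewrite tmulA.
  rewrite contraE -(sum_delta (fun k => comul (antipode (v j k)))).
  by apply: eq_bigr => k _; rewrite (linZ _ _ (m2 _)) tmul1r.
rewrite exchange_big /= -[RHS](sum_delta (T i)).
apply: eq_bigr => l _; rewrite -(lin_sum _ _ _ (m1 _)).
under eq_bigr do rewrite -comulM.
rewrite -linear_sum corep_antipodel // -scaler_nat linearZ /= comul1.
by rewrite (linZ _ _ (m1 _)) tmul1l eq_sym.
Qed.

End Corepresentations.

(** * Matrix coefficients of the r-form *)

Section MatrixFunctionals.
Variables (K : fieldType) (A : hopfType K).
Variables (n m : nat) (v : 'M[A]_n) (w : 'M[A]_m).
Hypotheses (cv : corep v) (cw : corep w).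
Notation J := ('I_n * 'I_m)%type.
Implicit Types f g : {scalar tensor A A}.

Lemma linear_pure_l f b : linear ((fun a => f (a ⊗ b)) : A -> K^o).
Proof. by move=> c x y; rewrite (tpure_bilinear _ _).1 linearP. Qed.

Lemma linear_pure_r f a : linear ((fun b => f (a ⊗ b)) : A -> K^o).
Proof. by move=> c x y; rewrite (tpure_bilinear _ _).2 linearP. Qed.

Lemma tsum2_corep (U : lmodType K) (F : A -> A -> A -> A -> U) i j k l :
  (forall a1 a2, is_bilinear (F a1 a2)) ->
  (forall b1 b2, is_bilinear (fun a1 a2 => F a1 a2 b1 b2)) ->
  tsum (fun a1 a2 => tsum (F a1 a2) (comul (w k l))) (comul (v i j))
  = \sum_(c : J) F (v i c.1) (v c.1 j) (w k c.2) (w c.2 l).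
Proof.
move=> F1 F2; rewrite cv.1 cw.1.
under eq_tsum => a1 a2 do rewrite tsum_sum //.
rewrite tsum_sum; first by rewrite pair_bigA.
exact: bilinear_sum.
Qed.

Lemma convolution_corep f g i j k l :
  convolution f g (v i j) (w k l)
  = \sum_(c : J) f (v i c.1 ⊗ w k c.2) * g (v c.1 j ⊗ w c.2 l).
Proof.
rewrite /convolution (@tsum2_corep K^o (fun a1 a2 b1 b2 =>
  f (a1 ⊗ b1) *: (g (a2 ⊗ b2) : K^o))) //.
- by move=> a1 a2; apply: bilinear_scale; apply: linear_pure_r.
- by move=> b1 b2; apply: bilinear_scale; apply: linear_pure_l.
Qed.

End MatrixFunctionals.

(** With index pairs for [J], this identifies two families of values of [r] or [rbar] as soon as
    they invert the same matrix from opposite sides. *)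
Lemma inv_unique (K : pzRingType) (J : finType) (f g h : J -> J -> K) :
  (forall a b, \sum_c f a c * g c b = (a == b)%:R) ->
  (forall a b, \sum_c g a c * h c b = (a == b)%:R) ->
  forall a b, f a b = h a b.
Proof.
move=> fg gh a b.
transitivity (\sum_c f a c * (c == b)%:R).
  rewrite (bigD1 b) //= eqxx mulr1 big1 ?addr0 // => c /negbTE ->.
  by rewrite mulr0.
under eq_bigr do rewrite -gh mulr_sumr.
rewrite exchange_big /=; under eq_bigr do (under eq_bigr do rewrite mulrA;
  rewrite -mulr_suml fg).
rewrite (bigD1 a) //= eqxx mul1r big1 ?addr0 // => c.
by rewrite eq_sym => /negbTE ->; rewrite mul0r.
Qed.

Section UniversalRForm.
Variables (K : fieldType) (A : hopfType K) (r rbar : {scalar tensor A A}).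
Hypothesis r_univ : universal_rform r rbar.

Section OneCorep.
Variables (m : nat) (w : 'M[A]_m).
Hypothesis cw : corep w.

Fact tsum_corep (f g : A -> K) i j :
  linear (f : A -> K^o) -> linear (g : A -> K^o) ->
  tsum (fun a1 a2 => f a1 * g a2) (comul (w i j)) = \sum_k f (w i k) * g (w k j).
Proof.
by move=> lf lg; rewrite cw.1 (@tsum_sum K A A K^o) //; apply: bilinear_scale.
Qed.

Lemma rform_mull_corep a b i j :
  r ((a * b) ⊗ w i j) = \sum_k r (a ⊗ w i k) * r (b ⊗ w k j).
Proof.
by rewrite (rform_mull r_univ) tsum_corep //; apply: linear_pure_r.
Qed.

Lemma rform_mulr_corep a b i j :
  r (w i j ⊗ (a * b)) = \sum_k r (w i k ⊗ b) * r (w k j ⊗ a).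
Proof.
by rewrite (rform_mulr r_univ) tsum_corep //; apply: linear_pure_l.
Qed.

(** F = F(FG) = (FF)G = FG = 1. It normalises [r] on the unit of [A]: there 1 = 1 * 1 makes the
    matrix idempotent, and [rbar] inverts it. *)
Fact idem_unit (F G : 'I_m -> 'I_m -> K) :
  (forall i j, F i j = \sum_k F i k * F k j) ->
  (forall i j, \sum_k F i k * G k j = (i == j)%:R) ->
  forall i j, F i j = (i == j)%:R.
Proof.
move=> FF FG i j; rewrite -FG.
have: \sum_k F i k * (k == j)%:R = F i j.
  rewrite (bigD1 j) //= eqxx mulr1 big1 ?addr0 // => k /negbTE ->.
  by rewrite mulr0.
move=> <-; under eq_bigr do rewrite -FG mulr_sumr.
rewrite exchange_big /=; apply: eq_bigr => k _.
by under eq_bigr do rewrite mulrA; rewrite -mulr_suml -FF.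
Qed.

Fact bilinear_pure_mul (f g : {scalar tensor A A}) (a b : A) :
  is_bilinear ((fun x y => f (x ⊗ a) * g (y ⊗ b)) : A -> A -> K^o).
Proof. by apply: bilinear_mul; apply: linear_pure_l. Qed.

Lemma rform_1l i j : r (1 ⊗ w i j) = (i == j)%:R.
Proof.
apply: (@idem_unit (fun k l => r (1 ⊗ w k l))
  (fun k l => rbar (1 ⊗ w k l))) => k l.
  by rewrite -{1}[1 : A]mul1r rform_mull_corep.
have := rform_convr r_univ 1 (w k l); rewrite counit1 mul1r cw.2 => <-.
rewrite /convolution comul1.
rewrite (eq_tsum (g := fun a1 a2 =>
    \sum_c r (a1 ⊗ w k c) * rbar (a2 ⊗ w c l))); last first.
  by move=> a1 a2; rewrite tsum_corep //; apply: linear_pure_r.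
rewrite (@tsum_pure K A A K^o) //.
by apply: (@bilinear_sum K A A K^o) => c; apply: bilinear_pure_mul.
Qed.

Lemma rform_1r i j : r (w i j ⊗ 1) = (i == j)%:R.
Proof.
apply: (@idem_unit (fun k l => r (w k l ⊗ 1))
  (fun k l => rbar (w k l ⊗ 1))) => k l.
  by rewrite -{1}[1 : A]mul1r rform_mulr_corep.
have := rform_convr r_univ (w k l) 1; rewrite counit1 mulr1 cw.2 => <-.
rewrite /convolution comul1.
rewrite (eq_tsum (g := fun a1 a2 => r (a1 ⊗ 1) * rbar (a2 ⊗ 1))).
  by rewrite tsum_corep //; apply: linear_pure_l.
move=> a1 a2; rewrite (@tsum_pure K A A K^o) //.
by apply: bilinear_mul; apply: linear_pure_r.
Qed.

End OneCorep.

Section TwoCoreps.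
Variables (n m : nat) (v : 'M[A]_n) (w : 'M[A]_m).
Hypotheses (cv : corep v) (cw : corep w).
Notation J := ('I_n * 'I_m)%type.

Lemma rform_rbar (a b : J) :
  \sum_(c : J) r (v a.1 c.1 ⊗ w a.2 c.2) * rbar (v c.1 b.1 ⊗ w c.2 b.2)
  = (a == b)%:R.
Proof.
by rewrite -convolution_corep // (rform_convr r_univ) cv.2 cw.2 -natrM mulnb.
Qed.

Lemma rbar_rform (a b : J) :
  \sum_(c : J) rbar (v a.1 c.1 ⊗ w a.2 c.2) * r (v c.1 b.1 ⊗ w c.2 b.2)
  = (a == b)%:R.
Proof.
by rewrite -convolution_corep // (rform_convl r_univ) cv.2 cw.2 -natrM mulnb.
Qed.

Lemma rform_braid_corep i j k l :
  \sum_(c : J) r (v i c.1 ⊗ w k c.2) *: (v c.1 j * w c.2 l)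
  = \sum_(c : J) r (v c.1 j ⊗ w c.2 l) *: (w k c.2 * v i c.1).
Proof.
have := rform_braid r_univ (v i j) (w k l).
rewrite (@tsum2_corep K A n m v w cv cw A
  (fun a1 a2 b1 b2 => r (a1 ⊗ b1) *: (a2 * b2))) //.
rewrite (@tsum2_corep K A n m v w cv cw A
  (fun a1 a2 b1 b2 => r (a2 ⊗ b2) *: (b1 * a1))) //.
- move=> a1 a2; split=> [b2 c x y|b1 c x y] /=.
    by rewrite mulrDl scalerDr -scalerAl !scalerA mulrC.
  by rewrite linear_pure_r scalerDl scalerA.
- move=> b1 b2; split=> [a2 c x y|a1 c x y] /=.
    by rewrite mulrDr scalerDr -scalerAr !scalerA mulrC.
  by rewrite linear_pure_l scalerDl scalerA.
- move=> a1 a2; apply: bilinear_scale; first exact: linear_pure_r.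
  exact: (mul_bilinear A).2.
- move=> b1 b2; apply: bilinear_scale; first exact: linear_pure_l.
  exact: (mul_bilinear A).1.
Qed.

(** Both sides invert the matrix of values r(v, w): [rbar] by convolution, and r(S(v), w) because
    multiplicativity in the first argument turns the product into r(v S(v), w). *)
Lemma rform_antipodel i j k l :
  r (antipode (v i j) ⊗ w k l) = rbar (v i j ⊗ w k l).
Proof.
symmetry.
apply: (@inv_unique K J (fun a b => rbar (v a.1 b.1 ⊗ w a.2 b.2))
  (fun a b => r (v a.1 b.1 ⊗ w a.2 b.2))
  (fun a b => r (antipode (v a.1 b.1) ⊗ w a.2 b.2)) _ _ (i, k) (j, l)).
  exact: rbar_rform.
move=> a b; rewrite -(pair_bigA _ (fun s t =>
  r (v a.1 s ⊗ w a.2 t) * r (antipode (v s b.1) ⊗ w t b.2))) /=.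
under eq_bigr do rewrite -rform_mull_corep //.
rewrite -(lin_sum _ _ _ (linear_pure_l r (w a.2 b.2))) corep_antipoder //.
rewrite -[X in X ⊗ _]scaler_nat (linZ _ _ (linear_pure_l r _)) rform_1l //.
by rewrite [_ *: _]mulr_natl mulrb [a == b]/eq_op /=; case: eqP.
Qed.

(** Multiplicativity in the second argument reverses the order of the factors. Hence r(v, S(w))
    inverts r(v, w) only after the indices of [w] are transposed, the product being r(v, S(w) w). *)
Lemma rform_antipoder_inv s p i j :
  \sum_(c : J) r (v s c.1 ⊗ w c.2 j) * r (v c.1 p ⊗ antipode (w i c.2))
  = ((s, j) == (p, i))%:R.
Proof.
rewrite -(pair_bigA _ (fun t k =>
  r (v s t ⊗ w k j) * r (v t p ⊗ antipode (w i k)))) exchange_big /=.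
under eq_bigr do rewrite -rform_mulr_corep //.
rewrite -(lin_sum _ _ _ (linear_pure_r r (v s p))) corep_antipodel //.
rewrite -[X in _ ⊗ X]scaler_nat (linZ _ _ (linear_pure_r r _)) rform_1r //.
rewrite [_ *: _]mulr_natl mulrb [RHS]/(nat_of_bool ((s == p) && (j == i)))%:R.
by rewrite (eq_sym i j); do 2 case: eqP.
Qed.

End TwoCoreps.

(** Both sides invert the values r(v, S(w)): the right one by [rform_antipoder_inv], the left one by
    convolution with the contragredient of [w]. *)
Lemma rbar_antipoder n m (v : 'M[A]_n) (w : 'M[A]_m)
    (cv : corep v) (cw : corep w) i j k l :
  rbar (v i j ⊗ antipode (w k l)) = r (v i j ⊗ w k l).
Proof.
symmetry.
apply: (@inv_unique K ('I_n * 'I_m)%type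
  (fun a b => r (v a.1 b.1 ⊗ w b.2 a.2))
  (fun a b => r (v a.1 b.1 ⊗ antipode (w b.2 a.2)))
  (fun a b => rbar (v a.1 b.1 ⊗ antipode (w b.2 a.2))) _ _ (i, l) (j, k)).
  by move=> [a1 a2] [b1 b2]; rewrite rform_antipoder_inv.
move=> a b; have := rform_rbar cv (corep_contragredient cw) a b.
by move=> <-; apply: eq_bigr => c _; rewrite !contraE.
Qed.

Section Commutation.
Variables (n m : nat) (v : 'M[A]_n) (w : 'M[A]_m).
Hypotheses (cv : corep v) (cw : corep w).
Notation J := ('I_n * 'I_m)%type.

(** The braid relation solved for v w: its [r] on the left is cancelled by convolution with
    [rbar]. *)
Lemma corep_mul_swap i j k l :
  v i j * w k l = \sum_(a : J) rbar (v i a.1 ⊗ w k a.2) *: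
    \sum_(c : J) r (v c.1 j ⊗ w c.2 l) *: (w a.2 c.2 * v a.1 c.1).
Proof.
under eq_bigr do rewrite -rform_braid_corep // scaler_sumr.
rewrite exchange_big /=.
transitivity (\sum_(c : J) ((i, k) == c)%:R *: (v c.1 j * w c.2 l)).
  rewrite (bigD1 (i, k)) //= eqxx scale1r big1 ?addr0 // => c.
  by rewrite eq_sym => /negbTE ->; rewrite scale0r.
apply: eq_bigr => c _; rewrite -(rbar_rform cv cw) scaler_suml.
by apply: eq_bigr => a _; rewrite scalerA.
Qed.

(** Each product v w is swapped by [corep_mul_swap]; the [r] this creates on the right is cancelled
    by the given [rbar]. *)
Lemma rbar_braid_corep i j k l :
  \sum_(c : J) rbar (v c.1 j ⊗ w c.2 l) *: (v i c.1 * w k c.2)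
  = \sum_(a : J) rbar (v i a.1 ⊗ w k a.2) *: (w a.2 l * v a.1 j).
Proof.
under eq_bigr do rewrite corep_mul_swap scaler_sumr.
rewrite exchange_big /=; apply: eq_bigr => a _.
under eq_bigr do rewrite scalerA mulrC -scalerA scaler_sumr.
rewrite -scaler_sumr; congr (_ *: _).
rewrite exchange_big /=.
transitivity (\sum_(c : J) (c == (j, l))%:R *: (w a.2 c.2 * v a.1 c.1)).
  apply: eq_bigr => c _; rewrite -(rform_rbar cv cw) scaler_suml.
  by apply: eq_bigr => b _; rewrite scalerA mulrC.
rewrite (bigD1 (j, l)) //= eqxx scale1r big1 ?addr0 // => c /negbTE ->.
by rewrite scale0r.
Qed.

End Commutation.

End UniversalRForm.

(** * The R-matrix and its contractions *)

Lemma sum_only (V : nmodType) (I : finType) (i0 : I) (F : I -> V) :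
  (forall i, i != i0 -> F i = 0) -> \sum_i F i = F i0.
Proof. by move=> F0; rewrite (bigD1 i0) //= big1 ?addr0. Qed.

Section RMatrixInverse.
Variables (K : fieldType) (n : nat) (q : K).
Hypothesis q_neq0 : q != 0.
Implicit Types i j k l m p : 'I_n.

(* The Hecke relation gives R^-1 = R - (q - q^-1). *)
Definition Rbar i j k l : K :=
  q ^- (i == j) *+ ((i == l) && (j == k))
  - (q - q^-1) *+ [&& (j < i)%N, i == k & j == l].

Lemma Rbar_sym i j k l : Rbar i j k l = Rbar k l i j.
Proof.
rewrite /Rbar (eq_sym k i) (eq_sym l j) (eq_sym k j) (eq_sym l i).
rewrite [(j == k) && _]andbC; congr (_ - _).
  by case: (i =P l) => //= ->; case: (j =P k) => //= ->; rewrite eq_sym.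
case: (i =P k) => [->|]; last by rewrite !andbF.
by case: (j =P l) => [->|] //; rewrite !andbF.
Qed.

Lemma Rhat_sym i j k l : Rhat q i j k l = Rhat q k l i j.
Proof.
rewrite /Rhat (eq_sym k i) (eq_sym l j) (eq_sym k j) (eq_sym l i).
rewrite [(j == k) && _]andbC; congr (_ + _).
  by case: (i =P l) => //= ->; case: (j =P k) => //= ->; rewrite eq_sym.
case: (i =P k) => [->|]; last by rewrite !andbF.
by case: (j =P l) => [->|] //; rewrite !andbF.
Qed.

(** Contraction over one upper and one lower index. The theta term of R then contributes a partial
    trace of F, which is what makes the systems below triangular. *)
Lemma sum_Rhat_cross (V : lmodType K) s j (F : 'I_n -> 'I_n -> V) :
  \sum_a \sum_b Rhat q b s a j *: F a b
  = q ^+ (j == s) *: F s j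
    + ((q - q^-1) *+ (s == j)) *: \sum_(k < n | (k < s)%N) F k k.
Proof.
under eq_bigr do (under eq_bigr do rewrite scalerDl; rewrite big_split /=).
rewrite big_split /=; congr (_ + _).
  rewrite (sum_only (i0 := s)) => [|a ja]; last first.
    by rewrite big1 // => b _; rewrite (eq_sym s a) (negbTE ja) andbF scale0r.
  rewrite (sum_only (i0 := j)) => [|b bj]; first by rewrite !eqxx.
  by rewrite (negbTE bj) scale0r.
rewrite scaler_sumr [RHS]big_mkcond; apply: eq_bigr => a _.
rewrite (sum_only (i0 := a)) => [|b ba]; last first.
  by rewrite (negbTE ba) andbF scale0r.
by rewrite eqxx /=; case: ifP; rewrite ?scale0r.
Qed.

Lemma sum_Rbar_cross (V : lmodType K) a i (F : 'I_n -> 'I_n -> V) :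
  \sum_k \sum_b Rbar k a b i *: F k b
  = q ^- (i == a) *: F i a
    - ((q - q^-1) *+ (a == i)) *: \sum_(k < n | (a < k)%N) F k k.
Proof.
under eq_bigr do (under eq_bigr do rewrite scalerBl; rewrite sumrB /=).
rewrite sumrB /=; congr (_ - _).
  rewrite (sum_only (i0 := i)) => [|k ki]; last first.
    by rewrite big1 // => b _; rewrite (negbTE ki) scale0r.
  rewrite (sum_only (i0 := a)) => [|b ba]; first by rewrite !eqxx.
  by rewrite (eq_sym a b) (negbTE ba) andbF scale0r.
rewrite scaler_sumr [RHS]big_mkcond; apply: eq_bigr => k _.
rewrite (sum_only (i0 := k)) => [|b bk]; last first.
  by rewrite (eq_sym k b) (negbTE bk) andbF scale0r.
by rewrite eqxx /=; case: ifP; rewrite ?scale0r.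
Qed.

Lemma sum_Rhat (V : lmodType K) i j (F : 'I_n -> 'I_n -> V) :
  \sum_k \sum_l Rhat q i j k l *: F k l
  = q ^+ (i == j) *: F j i + ((q - q^-1) *+ (i < j)%N) *: F i j.
Proof.
under eq_bigr do (under eq_bigr do rewrite scalerDl; rewrite big_split /=).
rewrite big_split /=; congr (_ + _).
  rewrite (sum_only (i0 := j)) => [|k kj]; last first.
    by rewrite big1 // => l _; rewrite (eq_sym j k) (negbTE kj) andbF scale0r.
  rewrite (sum_only (i0 := i)) => [|l li]; first by rewrite !eqxx.
  by rewrite (eq_sym i l) (negbTE li) scale0r.
rewrite (sum_only (i0 := i)) => [|k ki]; last first.
  by rewrite big1 // => l _; rewrite (eq_sym i k) (negbTE ki) andbF scale0r.
rewrite (sum_only (i0 := j)) => [|l lj]; first by rewrite !eqxx !andbT.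
by rewrite (eq_sym j l) (negbTE lj) !andbF scale0r.
Qed.

Lemma Rhat_Rbar i j m p :
  \sum_k \sum_l Rhat q i j k l * Rbar k l m p = ((i == m) && (j == p))%:R.
Proof.
rewrite (@sum_Rhat K^o i j (fun k l => Rbar k l m p)) /Rbar.
rewrite /GRing.scale /= (eq_sym j i).
case: (i =P j) => [<-|/eqP ij] /=.
  rewrite ltnn /= mulr0n mul0r addr0 subr0 expr1 mulrnAr mulfV //.
  by rewrite andbC.
rewrite expr0 invr1 mul1r.
case: (ltngtP i j) => [lij|lij|/val_inj e]; last by rewrite e eqxx in ij.
  rewrite /= (andbC (i == m)) (andbC (j == m)).
  by do 2 case: (_ && _) => /=; ring.
rewrite !mulr0n mul0r addr0 subr0 /=.
by rewrite andbC.
Qed.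

Lemma Rhat_invE i j k l : Rhat_inv q i j k l = Rbar i j k l.
Proof.
pose B : 'M[K]_#|{: 'I_n * 'I_n}| := \matrix_(a, b)
  Rbar (enum_val a).1 (enum_val a).2 (enum_val b).1 (enum_val b).2.
have RB : Rhat_mx n q *m B = 1%:M.
  apply/matrixP => a b; rewrite !mxE.
  rewrite (reindex (@enum_rank _)) /=; last first.
    by exists enum_val => x _; rewrite ?enum_rankK ?enum_valK.
  under eq_bigr do rewrite !mxE enum_rankK.
  rewrite -(pair_bigA _ (fun k l => Rhat q (enum_val a).1 (enum_val a).2 k l
    * Rbar k l (enum_val b).1 (enum_val b).2)) Rhat_Rbar.
  by rewrite -(inj_eq enum_val_inj).
(* [invmx] is a true inverse only on units, and the right inverse [B] supplies invertibility. *)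
have [uR _] := mulmx1_unit RB.
by rewrite /Rhat_inv -[invmx _]mulmx1 -RB mulKmx // mxE !enum_rankK.
Qed.

End RMatrixInverse.

Section LastIndex.
Variables (K : fieldType) (n : nat) (q : K).
Hypothesis q_neq0 : q != 0.
Notation N := (ord_max : 'I_n.+1).
Implicit Types i j k l m p : 'I_n.+1.

Lemma ltn_ord_max i : (N < i)%N = false.
Proof. by rewrite ltnNge -ltnS ltn_ord. Qed.

Lemma lt_ord_max i : (i < N)%N = (i != N).
Proof. by rewrite ltn_neqAle -ltnS ltn_ord andbT. Qed.

(** No index exceeds the last one, so the theta term drops out and the entry is monomial. This is
    what collapses the commutation rules later. *)
Lemma Rhat_lastl j k l :
  Rhat q N j k l = q ^+ (j == N) *+ ((l == N) && (j == k)).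
Proof.
rewrite /Rhat addrC; case: (N =P k) => [<-|_] /=; last first.
  by rewrite andbF add0r (eq_sym N j) (eq_sym N l).
case: (j =P N) => [->|/eqP jN].
  by rewrite ltnn eqxx add0r (eq_sym N l).
by rewrite ltn_ord_max add0r (eq_sym N l) (eq_sym N j) (negbTE jN).
Qed.

Lemma Rhat_lastr i j : Rhat q i j N N = q *+ ((i == N) && (j == N)).
Proof.
rewrite /Rhat; case: (i =P N) => [->|_] /=; last by rewrite andbF addr0.
by rewrite ltn_ord_max addr0; case: (j =P N) => [->|] //; rewrite eqxx expr1.
Qed.

Lemma Rbar_lastr i k l :
  Rbar q i N k l = q ^- (i == N) *+ ((i == l) && (k == N)).
Proof. by rewrite /Rbar ltn_ord_max subr0 (eq_sym N k). Qed.

End LastIndex.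

Lemma sum_ord_telescope (V : zmodType) (F : nat -> V) n m p :
  (m <= p <= n)%N ->
  \sum_(i < n | (m <= i < p)%N) (F i.+1 - F i) = F p - F m.
Proof.
case/andP=> mp pn; rewrite -telescope_sumr // (big_nat_widen _ p n) //.
rewrite big_geq_mkord; by apply: eq_bigl => i; rewrite andbC.
Qed.

(** * Values of the r-form on u, S(u) and S^2(u) *)

Section Duality.
Variables (K : fieldType) (A : hopfType K) (n : nat) (q : K).
Hypothesis q_neq0 : q != 0.
Variables (u : 'M[A]_n.+1) (r rbar : {scalar tensor A A}).
Hypotheses (cu : corep u) (r_univ : universal_rform r rbar).
Hypothesis r_u : forall i j k l, r (u i j ⊗ u k l) = Rhat q k i j l.
Notation N := (ord_max : 'I_n.+1).
Notation uc := (contragredient u).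
Let cuc : corep uc := corep_contragredient cu.

Lemma rbar_u i j k l : rbar (u i j ⊗ u k l) = Rbar q i k l j.
Proof.
symmetry.
apply: (@inv_unique K ('I_n.+1 * 'I_n.+1)%type
  (fun a b => Rbar q a.1 a.2 b.2 b.1)
  (fun a b => r (u a.1 b.1 ⊗ u a.2 b.2))
  (fun a b => rbar (u a.1 b.1 ⊗ u a.2 b.2)) _ _ (i, k) (j, l)).
  move=> a b; under eq_bigr do rewrite r_u mulrC.
  rewrite -(pair_bigA _ (fun c d => Rhat q d c b.1 b.2 * Rbar q a.1 a.2 d c)).
  rewrite exchange_big /=.
  under eq_bigr do (under eq_bigr do rewrite Rhat_sym Rbar_sym).
  by rewrite Rhat_Rbar // eq_sym (eq_sym b.2).
by move=> a b; apply: (rform_rbar r_univ cu cu).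
Qed.

(** The skew inverse of R: by [rform_antipoder_inv] it inverts R with one pair of indices
    transposed. *)
Definition skew_r s p i j : K := r (u s p ⊗ antipode (u i j)).
(** [sq_r k j i m] is the entry of the grave R-matrix with upper indices i, j and lower indices k,
    m. *)
Definition sq_r j i a c : K := r (antipode (antipode (u j i)) ⊗ u a c).

(** The skew inverse relation after [sum_Rhat_cross]. It is explicit for s != j; for s = j it
    involves only smaller indices, so induction upwards solves it. *)
Lemma skew_r_rec s p i j :
  q ^+ (j == s) * skew_r s p i j
  + ((q - q^-1) *+ (s == j)) * \sum_(k < n.+1 | (k < s)%N) skew_r k p i k
  = ((s == p) && (j == i))%:R.
Proof.
have := rform_antipoder_inv r_univ cu cu s p i j.
rewrite /eq_op /= => <-; under [RHS]eq_bigr do rewrite r_u.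
rewrite -(pair_bigA _ (fun a b => Rhat q b s a j * skew_r a p i b)) /=.
by rewrite (@sum_Rhat_cross K _ q K^o s j (fun a b => skew_r a p i b)).
Qed.

(** Convolution of r(S(u), u) = R^-1 with its inverse, which is r(S^2(u), u). Here the coupling is
    to larger indices, so induction runs downwards from the last one. *)
Lemma sq_r_rec j i a c :
  q ^- (i == a) * sq_r j i a c
  - ((q - q^-1) *+ (a == i)) * \sum_(k < n.+1 | (a < k)%N) sq_r j k k c
  = ((i == j) && (a == c))%:R.
Proof.
have := rform_rbar r_univ cuc cu (i, a) (j, c).
rewrite /eq_op /= => <-.
under [RHS]eq_bigr do rewrite -(rform_antipodel r_univ cuc cu) !contraE
  (rform_antipodel r_univ cu cu) rbar_u.
rewrite -(pair_bigA _ (fun k b => Rbar q k a b i * sq_r j k b c)) /=.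
by rewrite (@sum_Rbar_cross K _ q K^o a i (fun k b => sq_r j k b c)).
Qed.

Lemma skew_r_neq s p i j : s != j -> skew_r s p i j = ((s == p) && (j == i))%:R.
Proof.
move=> sj; rewrite -skew_r_rec (eq_sym j) (negbTE sj) mulr0n mul0r addr0.
by rewrite expr0 mul1r.
Qed.

Lemma skew_r_last s p j :
  skew_r s p N j = q ^- (s == N) *+ ((j == N) && (s == p)).
Proof.
have [->|sj] := eqVneq s j; last first.
  rewrite skew_r_neq // andbC; case: (j =P N) => [<-|] /=; last by [].
  by rewrite (negbTE sj) invr1 mulrb; case: (s == p).
have [m] := ubnP (j : nat); elim: m j => // m IH j jm.
(* The partial trace vanishes: its terms have k < j, hence k is not the last index, and the
   induction hypothesis makes them 0. *)
have := skew_r_rec j p N j; rewrite eqxx big1 => [|k kj]; last first.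
  rewrite IH; last exact: leq_trans kj _.
  case: (k =P N) => [kN|] //.
  by have := ltn_ord_max j; rewrite -kN kj.
rewrite mulr0 addr0 => /(congr1 ( *%R q^-1)); rewrite mulKf // => ->.
rewrite andbC; case: (j =P N) => [->|] /=; last by rewrite mulr0.
by rewrite mulr_natr.
Qed.

(** Telescoping, from (q - q^-1) q^-(2k+1) = q^-(2k) - q^-(2k+2). *)
Lemma sum_odd_powers m p : (m <= p <= n.+1)%N ->
  (q - q^-1) * \sum_(k < n.+1 | (m <= k < p)%N) q ^- k.*2.+1
  = q ^- m.*2 - q ^- p.*2.
Proof.
move=> mp; have := @sum_ord_telescope K (fun k => - q ^- k.*2) n.+1 m p mp.
rewrite opprK addrC => <-; rewrite mulr_sumr; apply: eq_bigr => k _.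
by rewrite doubleS !exprS; field; rewrite expf_neq0.
Qed.

(** Summing [skew_r_rec] over p = i gives, by strong induction, q x + (1 - q^-(2j)) = 1 for the
    trace x at s = j. Indices start at 0, whence the exponent 2j + 1. *)
Lemma skew_r_trace s j :
  \sum_p skew_r s p p j = q ^- (j.*2.+1) *+ (s == j).
Proof.
have [->|sj] := eqVneq s j; last first.
  rewrite (sum_only (i0 := j)) => [|p pj]; last first.
    by rewrite skew_r_neq // (eq_sym j) (negbTE pj) andbF.
  by rewrite skew_r_neq // (negbTE sj).
rewrite mulr1n; have [m] := ubnP (j : nat); elim: m j => // m IH j jm.
have: \sum_p (q ^+ (j == j) * skew_r j p p j
  + ((q - q^-1) *+ (j == j)) * \sum_(k < n.+1 | (k < j)%N) skew_r k p p k) = 1.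
  under eq_bigr do rewrite skew_r_rec.
  by rewrite (sum_only (i0 := j)) ?eqxx // => p; rewrite eq_sym => /negbTE ->.
rewrite eqxx big_split /= -!mulr_sumr exchange_big /= mulr1n.
under [X in _ + _ * X]eq_bigr => k kj do rewrite IH ?(leq_trans kj) //.
rewrite (@sum_odd_powers 0 j) //=; last first.
  exact: ltnW (ltn_ord j).
rewrite double0 expr0 invr1 expr1.
move/(canRL (addrK _))/(congr1 ( *%R q^-1)); rewrite mulKf // => ->.
by rewrite exprS invfM subKr.
Qed.

Lemma sq_r_neq j i a c : i != a -> sq_r j i a c = ((i == j) && (a == c))%:R.
Proof.
move=> ia; rewrite -sq_r_rec (eq_sym a) (negbTE ia) mulr0n mul0r subr0.
by rewrite expr0 invr1 mul1r.
Qed.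

(* The exchange relation yields r(S^2(u^m_i), u^j_k) where the theorem has
   r(S^2(u^k_j), u^i_m). *)
Lemma sq_r_sym i j k m : sq_r k j i m = sq_r m i j k.
Proof.
have [->|ij] := eqVneq i j; last first.
  by rewrite (sq_r_neq m k ij) andbC sq_r_neq // eq_sym.
(* Downward induction on j. The equations for the two sides have the same right-hand side and, by
   induction, the same partial trace. *)
have [l] := ubnP (n - j)%N; elim: l j => // l IH j jl.
have E : \sum_(p < n.+1 | (j < p)%N) sq_r k p p m
    = \sum_(p < n.+1 | (j < p)%N) sq_r m p p k.
  apply: eq_bigr => p jp; apply: IH.
  by rewrite -ltnS (leq_trans _ jl) // ltnS ltn_sub2l // (leq_trans jp) // -ltnS.
have := sq_r_rec m j j k; rewrite andbC -(sq_r_rec k j j m) E => /addIr.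
by move/(mulfI (invr_neq0 (expf_neq0 _ q_neq0))).
Qed.

End Duality.

(** * Forms of a calculus on matrix coefficients *)

Section Calculus.
Variables (K : fieldType) (A : hopfType K) (Gam : fodc A).
Implicit Types (g h : Gam) (a b : A).

Let lactl (g : Gam) : linear ((fun a : A => a *> g) : A -> Gam) :=
  (lact_bilinear Gam).1 g.
Let lactr (a : A) : linear ((fun g : Gam => a *> g) : Gam -> Gam) :=
  (lact_bilinear Gam).2 a.
Let ractl (a : A) : linear ((fun g : Gam => g <* a) : Gam -> Gam) :=
  (ract_bilinear Gam).1 a.

Lemma lact_suml (I : finType) (x : I -> A) g :
  (\sum_i x i) *> g = \sum_i (x i *> g).
Proof. exact: lin_sum (lactl g). Qed.

Lemma lact_sumr (I : finType) a (w : I -> Gam) :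
  a *> (\sum_i w i) = \sum_i (a *> w i).
Proof. exact: lin_sum (lactr a). Qed.

Lemma lactZr c a g : a *> (c *: g) = c *: (a *> g).
Proof. exact: linZ (lactr a). Qed.

Lemma ract_suml (I : finType) (w : I -> Gam) a :
  (\sum_i w i) <* a = \sum_i (w i <* a).
Proof. exact: lin_sum (ractl a). Qed.

Lemma diff1 : diff Gam 1 = 0.
Proof.
have := diffM Gam 1 1; rewrite mulr1 lact1 ract1.
by move=> E; apply: (addrI (diff Gam 1)); rewrite addr0 -E.
Qed.

Section NormalForm.
Variables (I J L : finType) (x : I -> A) (w : L -> Gam) (c : K).

(** This lemma and the next bring the two sides of a commutation relation to the form of a sum of
    a_s w_s, so that only coefficients in [A] remain to be compared. *)
Lemma lact_normal_left (F : I -> J -> L -> K) (y : J -> A) :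
  \sum_k x k *> (c *: \sum_a \sum_s F k a s *: (y a *> w s))
  = c *: \sum_s (\sum_k \sum_a F k a s *: (x k * y a)) *> w s.
Proof.
transitivity (c *: \sum_k \sum_s \sum_a (F k a s *: (x k * y a)) *> w s).
  rewrite scaler_sumr; apply: eq_bigr => k _; rewrite lactZr; congr (_ *: _).
  rewrite lact_sumr exchange_big; apply: eq_bigr => a _ /=.
  rewrite lact_sumr; apply: eq_bigr => s _.
  by rewrite lactZr lactZl lactM.
rewrite exchange_big /=; congr (_ *: _); apply: eq_bigr => s _.
by rewrite lact_suml; apply: eq_bigr => k _; rewrite lact_suml.
Qed.

Lemma lact_normal_right (e : I -> J -> K) (z : J -> L -> A) :
  c *: \sum_k \sum_m e k m *: (x k *> \sum_s (z m s *> w s))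
  = c *: \sum_s (\sum_k \sum_m e k m *: (x k * z m s)) *> w s.
Proof.
congr (_ *: _); transitivity
  (\sum_k \sum_s \sum_m (e k m *: (x k * z m s)) *> w s).
  apply: eq_bigr => k _; rewrite exchange_big; apply: eq_bigr => m _ /=.
  rewrite lact_sumr scaler_sumr; apply: eq_bigr => s _.
  by rewrite lactZl lactM.
rewrite exchange_big /=; apply: eq_bigr => s _.
by rewrite lact_suml; apply: eq_bigr => k _; rewrite lact_suml.
Qed.

End NormalForm.

Variables (n : nat) (u : 'M[A]_n).
Hypothesis cu : corep u.

Lemma omega_corep i j :
  omega Gam (u i j) = \sum_m antipode (u i m) *> diff Gam (u m j).
Proof.
rewrite /omega cu.1 tsum_sum //.
exact: bilinear_comp (lact_bilinear Gam) (linearP _) (linearP _).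
Qed.

Lemma diff_corep i j :
  diff Gam (u i j) = \sum_k u i k *> omega Gam (u k j).
Proof.
under eq_bigr do rewrite omega_corep lact_sumr.
rewrite exchange_big /= (sum_only (i0 := i)) => [|m mi].
  under eq_bigr do rewrite -lactM.
  by rewrite -lact_suml corep_antipoder // eqxx lact1.
under eq_bigr do rewrite -lactM.
rewrite -lact_suml corep_antipoder // eq_sym (negbTE mi).
exact: bilin0l (lact_bilinear Gam).
Qed.

(** Differentiate u S(u) = 1, then cancel u by multiplying with S(u) from the left. *)
Lemma diff_antipode i j :
  diff Gam (antipode (u i j))
  = - \sum_p omega Gam (u i p) <* antipode (u p j).
Proof.
have L m : \sum_p u m p *> diff Gam (antipode (u p j))
    = - \sum_p diff Gam (u m p) <* antipode (u p j).
  apply/eqP; rewrite -addr_eq0 -big_split /=.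
  under eq_bigr do rewrite -diffM.
  rewrite -linear_sum corep_antipoder //.
  by rewrite -[X in diff _ X]scaler_nat linearZ /= diff1 scaler0.
transitivity (\sum_m antipode (u i m) *> \sum_p u m p *> diff Gam (antipode (u p j))).
  under eq_bigr do rewrite lact_sumr.
  rewrite exchange_big /= (sum_only (i0 := i)) => [|p pi].
    under eq_bigr do rewrite -lactM.
    by rewrite -lact_suml corep_antipodel // eqxx lact1.
  under eq_bigr do rewrite -lactM.
  rewrite -lact_suml corep_antipodel // eq_sym (negbTE pi).
  exact: bilin0l (lact_bilinear Gam).
under eq_bigr do rewrite L -scaleN1r lactZr lact_sumr.
rewrite -scaler_sumr scaleN1r exchange_big /=; congr (- _).
apply: eq_bigr => p _; rewrite omega_corep ract_suml.
by apply: eq_bigr => m _; rewrite lractA.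
Qed.

Variables (r rbar : {scalar tensor A A}).
Hypothesis comm : omega_commutation u r rbar Gam.

(** The corepresentation is arbitrary because the rule is applied both to u and to its
    contragredient. *)
Lemma omega_commut_corep m (v : 'M[A]_m) (cv : corep v) i j k l :
  omega Gam (u i j) <* v k l
  = \sum_s \sum_t \sum_c \sum_e
      (r (v c e ⊗ u i s) * rbar (u t j ⊗ antipode (v e l)))
        *: (v k c *> omega Gam (u s t)).
Proof.
rewrite comm; apply: eq_bigr => s _; apply: eq_bigr => t _.
set w := omega Gam (u s t).
have lp c x y : lplus u r i s (c *: x + y) = c * lplus u r i s x + lplus u r i s y.
  exact: linear_pure_l.
have lm c x y : dual_antipode (lminus u rbar t j) (c *: x + y)
    = c * dual_antipode (lminus u rbar t j) x + dual_antipode (lminus u rbar t j) y.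
  by rewrite /dual_antipode /lminus linearP; exact: linear_pure_r.
have bin a1 : is_bilinear (fun a2 a3 =>
    (lplus u r i s a2 * dual_antipode (lminus u rbar t j) a3) *: (a1 *> w)).
  split=> [y c x x'|x c y y'].
    by rewrite lp mulrDl scalerDl -mulrA scalerA.
  by rewrite lm mulrDr scalerDl mulrCA scalerA.
rewrite cv.1 tsum_sum; last first.
  split=> [y c x x'|x c y y'].
    rewrite /tsum /pairsum scaler_sumr -big_split; apply: eq_bigr => p _ /=.
    by rewrite lactl scalerDr !scalerA mulrC.
  by rewrite linearP (tsum_linear (bin _)).
by apply: eq_bigr => c _; rewrite cv.1 tsum_sum.
Qed.

End Calculus.

(** * Commutation relations on the generators of Z *)

Lemma scale_sum_exchange (K : fieldType) (V : lmodType K) (P Q S : finType)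
    (c : P -> K) (z : Q -> K) (a : P -> S -> K) (x : Q -> S -> V) :
  \sum_i c i *: (\sum_j z j *: \sum_l a i l *: x j l)
  = \sum_j z j *: \sum_l (\sum_i a i l * c i) *: x j l.
Proof.
under eq_bigr do rewrite scaler_sumr.
rewrite exchange_big; apply: eq_bigr => j _ /=.
under [in RHS]eq_bigr do rewrite scaler_suml.
rewrite [in RHS]exchange_big scaler_sumr; apply: eq_bigr => i _ /=.
rewrite scalerA mulrC -scalerA scaler_sumr; congr (_ *: _).
by apply: eq_bigr => l _; rewrite scalerA mulrC.
Qed.

Section GammaBiRelations.
Variables (K : fieldType) (A : hopfType K) (n : nat) (q : K).
Hypothesis q_neq0 : q != 0.
Variables (u : 'M[A]_n.+1) (r rbar : {scalar tensor A A}) (Gam : fodc A).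
Hypotheses (cu : corep u) (r_univ : universal_rform r rbar).
Hypothesis r_u : forall i j k l, r (u i j ⊗ u k l) = Rhat q k i j l.
Hypothesis comm : omega_commutation u r rbar Gam.
Hypothesis rtt : RTT q u.
Notation N := (ord_max : 'I_n.+1).
Notation uc := (contragredient u).
Notation Su i j := (antipode (u i j)).
Notation Om i j := (omega Gam (u i j)).
Notation skew := (skew_r u r).
Let cuc : corep uc := corep_contragredient cu.
Let rbaru := rbar_u q_neq0 cu r_univ r_u.

Lemma omega_mul_u i j k l :
  Om i j <* u k l = \sum_s \sum_t \sum_a \sum_e
    (Rhat q i a e s * Rhat q e t j l) *: (u k a *> Om s t).
Proof.
rewrite (omega_commut_corep comm cu); apply: eq_bigr => s _.
apply: eq_bigr => t _; apply: eq_bigr => a _; apply: eq_bigr => e _.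
by rewrite (rbar_antipoder r_univ cu cu) !r_u.
Qed.

Lemma omega_mul_Su i j k l :
  Om i j <* Su k l = \sum_s \sum_t \sum_a \sum_e
    (Rbar q e i s a * skew t j k e) *: (Su a l *> Om s t).
Proof.
rewrite -contraE (omega_commut_corep comm cuc); apply: eq_bigr => s _.
apply: eq_bigr => t _; apply: eq_bigr => a _; apply: eq_bigr => e _.
rewrite (rbar_antipoder r_univ cu cuc) !contraE.
by rewrite (rform_antipodel r_univ cu cu) rbaru.
Qed.

(** [Rhat_lastr] forces t = e = N in [omega_mul_u]: right multiplication by x_j keeps the left span
    of the forms omega_sN stable. The next three lemmas are analogous, with omega_Nt in place of
    omega_sN in two of them. *)
Lemma omega_x k j :
  Om k N <* u j N
  = q *: \sum_a \sum_s Rhat q k a N s *: (u j a *> Om s N).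
Proof.
rewrite omega_mul_u [in RHS]exchange_big scaler_sumr; apply: eq_bigr => s _ /=.
rewrite (sum_only (i0 := N)) => [|t tN]; last first.
  rewrite big1 // => a _; rewrite big1 // => e _.
  by rewrite Rhat_lastr (negbTE tN) andbF mulr0 scale0r.
rewrite scaler_sumr; apply: eq_bigr => a _.
rewrite (sum_only (i0 := N)) => [|e eN]; last first.
  by rewrite Rhat_lastr (negbTE eN) mulr0 scale0r.
by rewrite Rhat_lastr eqxx scalerA mulrC.
Qed.

Lemma omega_last_x b j :
  Om N b <* u j N
  = \sum_a \sum_t (q ^+ (a == N) * Rhat q a t b N) *: (u j a *> Om N t).
Proof.
rewrite omega_mul_u (sum_only (i0 := N)) => [|s sN]; last first.
  rewrite big1 // => t _; rewrite big1 // => a _; rewrite big1 // => e _.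
  by rewrite Rhat_lastl (negbTE sN) mul0r scale0r.
rewrite exchange_big; apply: eq_bigr => a _; apply: eq_bigr => t _ /=.
rewrite (sum_only (i0 := a)) => [|e ea]; last first.
  by rewrite Rhat_lastl (eq_sym a e) (negbTE ea) andbF mul0r scale0r.
by rewrite Rhat_lastl !eqxx.
Qed.

Lemma omega_y k j :
  Om k N <* Su N j
  = q^-1 *: \sum_a \sum_s Rbar q N k s a *: (Su a j *> Om s N).
Proof.
rewrite omega_mul_Su [in RHS]exchange_big scaler_sumr; apply: eq_bigr => s _ /=.
rewrite (sum_only (i0 := N)) => [|t tN]; last first.
  rewrite big1 // => a _; rewrite big1 // => e _.
  by rewrite (skew_r_last q_neq0 cu r_univ) // (negbTE tN) andbF mulr0 scale0r.
rewrite scaler_sumr; apply: eq_bigr => a _.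
rewrite (sum_only (i0 := N)) => [|e eN]; last first.
  by rewrite (skew_r_last q_neq0 cu r_univ) // (negbTE eN) mulr0 scale0r.
by rewrite (skew_r_last q_neq0 cu r_univ) // eqxx scalerA mulrC.
Qed.

Lemma omega_last_Su b k l :
  Om N b <* Su k l
  = \sum_a \sum_t (q ^- (a == N) * skew t b k a) *: (Su a l *> Om N t).
Proof.
rewrite omega_mul_Su (sum_only (i0 := N)) => [|s sN]; last first.
  rewrite big1 // => t _; rewrite big1 // => a _; rewrite big1 // => e _.
  by rewrite Rbar_lastr (negbTE sN) andbF mul0r scale0r.
rewrite exchange_big; apply: eq_bigr => a _; apply: eq_bigr => t _ /=.
rewrite (sum_only (i0 := a)) => [|e ea]; last first.
  by rewrite Rbar_lastr (negbTE ea) mul0r scale0r.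
by rewrite Rbar_lastr !eqxx.
Qed.

(* Minus the product of l^{+N}_N(S(u^b_b)) and sum_p r(u^b_p, S(u^p_b)),
   so that omega(S(u^N_b)) = ycoef b * omega_Nb. *)
Definition ycoef (b : 'I_n.+1) : K := - (q ^- (b == N) * q ^- b.*2.+1).

(** Moving S(u) to the left of omega_Np produces the trace of [skew], which is diagonal, so each
    omega_Nb keeps a single coefficient. *)
Lemma diff_y i :
  diff Gam (Su N i) = \sum_b (ycoef b *: Su b i) *> Om N b.
Proof.
rewrite (diff_antipode Gam cu) -sumrN.
transitivity (\sum_p \sum_a \sum_t
   (- (q ^- (a == N) * skew t p p a)) *: (Su a i *> Om N t)).
  apply: eq_bigr => p _; rewrite omega_last_Su -sumrN; apply: eq_bigr => a _.
  by rewrite -sumrN; apply: eq_bigr => t _; rewrite scaleNr.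
rewrite exchange_big; apply: eq_bigr => a _; rewrite exchange_big /=.
rewrite (sum_only (i0 := a)) => [|t ta]; rewrite -scaler_suml sumrN -mulr_sumr
  (skew_r_trace q_neq0 cu r_univ r_u).
  by rewrite eqxx lactZl.
by rewrite (negbTE ta) mulr0 oppr0 scale0r.
Qed.

(** Comparing the coefficients of omega_sN leaves exactly the RTT relation. *)
Lemma diff_x_mul_x i j :
  diff Gam (u i N) <* u j N
  = q *: \sum_k \sum_m Rhat q i j k m *: (u k N *> diff Gam (u m N)).
Proof.
rewrite (diff_corep Gam cu) ract_suml.
under eq_bigr do rewrite lractA omega_x.
rewrite (lact_normal_left (u i) (fun s => Om s N)).
under [in RHS]eq_bigr do (under eq_bigr do rewrite (diff_corep Gam cu)).
rewrite (lact_normal_right (u^~ N) (fun s => Om s N)); congr (_ *: _).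
apply: eq_bigr => s _; rewrite rtt; congr (_ *> _).
Qed.

(** Comparing the coefficients of omega_sN leaves the braid relation between S(u) and u. *)
Lemma diff_x_mul_y i j :
  diff Gam (u i N) <* Su N j
  = q^-1 *: \sum_k \sum_m Rbar q k i m j *: (Su N k *> diff Gam (u m N)).
Proof.
rewrite (diff_corep Gam cu) ract_suml.
under eq_bigr do rewrite lractA omega_y.
rewrite (lact_normal_left (u i) (fun s => Om s N)).
under [in RHS]eq_bigr do (under eq_bigr do rewrite (diff_corep Gam cu)).
rewrite (lact_normal_right (fun k => Su N k) (fun s => Om s N)).
congr (_ *: _); apply: eq_bigr => s _; congr (_ *> _).
have := rform_braid_corep r_univ cuc cu j N i s.
under eq_bigr do rewrite !contraE (rform_antipodel r_univ cu cu) rbaru.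
under [in RHS]eq_bigr do rewrite !contraE (rform_antipodel r_univ cu cu) rbaru.
rewrite -(pair_bigA _ (fun k m => Rbar q k i m j *: (Su N k * u m s))) /= => ->.
rewrite -(pair_bigA _ (fun c k => Rbar q N k s c *: (u i k * Su c j))) /=.
by rewrite exchange_big.
Qed.

Lemma diff_y_mul_y i j :
  diff Gam (Su N i) <* Su N j
  = q^-1 *: \sum_k \sum_m Rbar q j i m k *: (Su N k *> diff Gam (Su N m)).
Proof.
rewrite diff_y ract_suml.
(* A factor q^-1 q is inserted so that q^-1 stands in front on both sides; the q is absorbed once
   the coefficients collapse at a = N. *)
transitivity (\sum_b (ycoef b *: Su b i) *> (q^-1 *: \sum_a \sum_t
    (q * (q ^- (a == N) * skew t b N a)) *: (Su a j *> Om N t))).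
  apply: eq_bigr => b _; rewrite lractA omega_last_Su scaler_sumr.
  congr (_ *> _); apply: eq_bigr => a _; rewrite scaler_sumr.
  by apply: eq_bigr => t _; rewrite scalerA mulKf.
rewrite (lact_normal_left _ (fun s => Om N s)).
under [in RHS]eq_bigr do (under eq_bigr do rewrite diff_y).
rewrite (lact_normal_right (fun k => Su N k) (fun s => Om N s)).
congr (_ *: _); apply: eq_bigr => s _; congr (_ *> _).
rewrite (sum_only (i0 := s)) => [|b bs]; last first.
  rewrite big1 // => a _; rewrite (skew_r_last q_neq0 cu r_univ) //.
  by rewrite (eq_sym s b) (negbTE bs) andbF !mulr0 scale0r.
rewrite (sum_only (i0 := N)) => [|a aN]; last first.
  by rewrite (skew_r_last q_neq0 cu r_univ) // (negbTE aN) !mulr0 scale0r.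
rewrite (skew_r_last q_neq0 cu r_univ) // !eqxx expr1 mulr1n mulVKf //.
(* The remaining identity is the inverse braid relation of S(u) with itself, whose left side reduces
   to one monomial by [Rbar_lastr]. *)
have := rbar_braid_corep r_univ cuc cuc i s j N.
have rcc a b c d : rbar (uc a b ⊗ uc c d) = Rbar q b d c a.
  rewrite [uc c d]contraE (rbar_antipoder r_univ cuc cu) contraE.
  by rewrite (rform_antipodel r_univ cu cu) rbaru.
under eq_bigr do rewrite rcc !contraE.
under [in RHS]eq_bigr do rewrite rcc !contraE.
rewrite (sum_only (i0 := (s, N))) => [|[a b] ab]; last first.
  rewrite Rbar_lastr /= (eq_sym s a); move: ab; rewrite /eq_op /= => /negbTE ->.
  by rewrite scale0r.
rewrite Rbar_lastr !eqxx mulr1n /= => E.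
rewrite -scalerAl scalerA mulrC -scalerA E scaler_sumr.
rewrite -(pair_bigA _ (fun m k => ycoef s *: (Rbar q m k j i *: (Su N k * Su s m)))).
rewrite exchange_big /=; apply: eq_bigr => k _; apply: eq_bigr => m _.
by rewrite -scalerAr !scalerA mulrC Rbar_sym.
Qed.

(** The scalar identity behind [diff_y_mul_x]. Contracting R by [sum_Rhat_cross] leaves a single
    term for t != N; for t = N a partial trace is added, which must cancel that term when s = l !=
    N. *)
Lemma ycoef_sum l s t :
  \sum_b \sum_a (Rbar q b l a s *
    (q^-1 * (q ^+ (a == N) * Rhat q a t b N) * ycoef b))
  = ycoef t *+ ((s == t) && (l == N)).
Proof.
transitivity (\sum_b \sum_a Rhat q a t b N *:
    (Rbar q b l a s * q^-1 * q ^+ (a == N) * ycoef b : K^o)).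
  apply: eq_bigr => b _; apply: eq_bigr => a _.
  by rewrite /GRing.scale /=; ring.
rewrite sum_Rhat_cross /GRing.scale /= (eq_sym N t) eqxx.
have [->|tN] := eqVneq t N; last first.
  rewrite !(mulr0n, mul0r, addr0, expr0, mul1r) /= expr1 mulfVK //.
  rewrite /Rbar (negbTE tN) /= andbF subr0 (eq_sym t s).
  case: (l =P N) => [->|]; last by rewrite andbF mul0r.
  by rewrite (negbTE tN) invr1 andbT mulr_natl.
rewrite mulr1n.
have -> : \sum_(k < n.+1 | (k < N)%N)
    (Rbar q k l k s * q^-1 * q ^+ (k == N) * ycoef k)
  = q^-1 * \sum_(k < n.+1 | (k < N)%N) (Rbar q k l k s * - q ^- k.*2.+1).
  rewrite mulr_sumr; apply: eq_bigr => k; rewrite lt_ord_max /ycoef => /negbTE ->.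
  by rewrite expr0 invr1; ring.
have [->|sl] := eqVneq s l; last first.
  rewrite big1 => [|k kN]; last first.
    rewrite /Rbar (eq_sym l s) (negbTE sl) !andbF /= subr0.
    case: (k =P s) => [->|]; last by rewrite mul0r.
    by rewrite (eq_sym l s) (negbTE sl) mul0r.
  rewrite !mulr0 addr0 /Rbar lt_ord_max eqxx (eq_sym l s) (negbTE sl) !andbF.
  rewrite subr0 (eq_sym N s); case: (s =P N) => [sN|]; last first.
    by rewrite /= ?mulr0n !(mulr0, mul0r).
  by move: sl; rewrite sN eq_sym => /negbTE ->; rewrite /= ?mulr0n !(mulr0, mul0r).
have [->|lN] := eqVneq l N.
  rewrite big1 => [|k]; last first.
    rewrite lt_ord_max => kN.
    by rewrite Rbar_lastr (negbTE kN) mul0r.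
  rewrite /Rbar ltnn !eqxx /= subr0 !mulr0 addr0 !expr1 !mulr1n.
  by field.
(* The term k = l gives - q^-(2l+2), the terms k > l give odd powers. After telescoping, - q^-(2n)
   remains, which cancels the term at the last index. *)
have -> : \sum_(k < n.+1 | (k < N)%N) (Rbar q k l k l * - q ^- k.*2.+1)
  = - q ^- l.*2.+2 + (q - q^-1) * \sum_(k < n.+1 | (l.+1 <= k < N)%N) q ^- k.*2.+1.
  rewrite (eq_bigr (fun k : 'I_n.+1 => (- q ^- l.*2.+2) *+ (k == l)
      + ((q - q^-1) * q ^- k.*2.+1) *+ (l < k)%N)) => [|k _].
    rewrite big_split /= (bigD1 l) ?lt_ord_max //= eqxx big1 => [|k]; last first.
      by case/andP=> _ /negbTE ->.
    rewrite addr0 mulr_sumr; congr (_ + _).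
    rewrite [RHS](eq_bigl (fun k : 'I_n.+1 => (k < N) && (l < k))%N) => [|k].
      by rewrite [RHS]big_mkcondr; apply: eq_bigr => k _; rewrite mulrb.
    by rewrite andbC.
  rewrite /Rbar !eqxx; case: (k =P l) => [->|_] /=.
    by rewrite ltnn eqxx expr1 mulr0n subr0 addr0 mulrN [in RHS]exprS invfM.
  by rewrite andbT !mulr0n sub0r add0r mulrNN mulrnAl.
rewrite (sum_odd_powers q_neq0); last first.
  by rewrite lt_ord_max lN /= ltnW.
rewrite /Rbar lt_ord_max lN !eqxx /= !expr1 (eq_sym _ l) (negbTE lN) /= /ycoef eqxx.
rewrite doubleS !exprS /=. field.
by rewrite q_neq0 !expf_neq0 ?oner_neq0.
Qed.

(** Swapping S(u) past u brings in r(S^2(u), u) on the left and R^-1 on the right; summed against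
    the coefficients of dy, the latter collapses by [ycoef_sum] to s = t and l = N, that is, to x_k
    y_m-type coefficients. *)
Lemma diff_y_mul_x i j :
  diff Gam (Su N i) <* u j N
  = q *: \sum_k \sum_m sq_r u r k j i m *: (u k N *> diff Gam (Su N m)).
Proof.
rewrite diff_y ract_suml.
transitivity (\sum_b (ycoef b *: Su b i) *> (q *: \sum_a \sum_t
    (q^-1 * (q ^+ (a == N) * Rhat q a t b N)) *: (u j a *> Om N t))).
  apply: eq_bigr => b _; rewrite lractA omega_last_x scaler_sumr.
  congr (_ *> _); apply: eq_bigr => a _; rewrite scaler_sumr.
  by apply: eq_bigr => t _; rewrite scalerA mulVKf.
rewrite (lact_normal_left _ (fun s => Om N s)).
under [in RHS]eq_bigr do (under eq_bigr do rewrite diff_y).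
rewrite (lact_normal_right (u^~ N) (fun s => Om N s)).
congr (_ *: _); apply: eq_bigr => t _; congr (_ *> _).
have swap b a : Su b i * u j a = \sum_k \sum_m sq_r u r k j i m *:
    \sum_s \sum_l Rbar q b l a s *: (u k l * Su s m).
  rewrite -contraE (corep_mul_swap r_univ cuc cu) exchange_big pair_bigA /=.
  apply: eq_bigr => -[m k] _ /=; rewrite (sq_r_sym q_neq0 cu r_univ r_u) pair_bigA.
  rewrite -(rform_antipodel r_univ cuc cu) contraE; congr (_ *: _).
  apply: eq_bigr => -[s l] _ /=.
  by rewrite !contraE (rform_antipodel r_univ cu cu) rbaru.
transitivity (\sum_(p : 'I_n.+1 * 'I_n.+1)
  (q^-1 * (q ^+ (p.2 == N) * Rhat q p.2 t p.1 N) * ycoef p.1) *: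
  \sum_(k : 'I_n.+1 * 'I_n.+1) sq_r u r k.1 j i k.2 *:
  \sum_(s : 'I_n.+1 * 'I_n.+1) Rbar q p.1 s.2 p.2 s.1 *: (u k.1 s.2 * Su s.1 k.2)).
  rewrite pair_bigA; apply: eq_bigr => -[b a] _ /=.
  rewrite -scalerAl scalerA swap pair_bigA; congr (_ *: _).
  by apply: eq_bigr => -[k m] _ /=; rewrite pair_bigA.
rewrite scale_sum_exchange pair_bigA; apply: eq_bigr => -[k m] _ /=.
congr (_ *: _); rewrite (sum_only (i0 := (t, N))) => [|[s l] sl].
  rewrite -(pair_bigA _ (fun b a => Rbar q b N a t *
    (q^-1 * (q ^+ (a == N) * Rhat q a t b N) * ycoef b))) /= ycoef_sum !eqxx.
  by rewrite scalerAr.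
rewrite -(pair_bigA _ (fun b a => Rbar q b l a s *
  (q^-1 * (q ^+ (a == N) * Rhat q a t b N) * ycoef b))) /= ycoef_sum.
by move: sl; rewrite /eq_op /= => /negbTE ->; rewrite scale0r.
Qed.

End GammaBiRelations.

(** * Left covariance of the induced calculus *)

Section Retraction.
Variables (K : fieldType) (V W : lmodType K) (f : V -> W).
Hypotheses (lf : linear f) (f_inj : injective f).

Let f0 : f 0 = 0.
Proof. by have := linZ 0 0 lf; rewrite !scale0r. Qed.

(** Partial retractions are encoded as graphs, so that extension is inclusion and the union of a
    chain is again a candidate. The domain is a subspace containing the image of [f]. *)
Definition partial_retraction (G : W -> V -> Prop) : Prop :=
  [/\ forall v, G (f v) v,
      forall w v v', G w v -> G w v' -> v = v' &
      forall c w w' v v', G w v -> G w' v' -> G (c *: w + w') (c *: v + v')].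

Lemma linear_retraction : exists2 p : W -> V, linear p & cancel f p.
Proof.
pose T := {G : W -> V -> Prop | partial_retraction G}.
pose R (G H : T) := `[< forall w v, sval G w v -> sval H w v >].
have G0 : partial_retraction (fun w v => w = f v).
  by split=> // [w v v' -> /f_inj //|c w w' v v' -> ->]; rewrite lf.
have [|||C totC|[G PG] Gmax] := @Zorn T R.
- by move=> G; apply/asboolP.
- by move=> G H L /asboolP GH /asboolP HL; apply/asboolP => w v /GH/HL.
- move=> [G PG] [H PH] /asboolP GH /asboolP HG.
  have E : G = H by apply/funext => w; apply/funext => v; apply/propext; split;
    [exact: GH|exact: HG].
  by subst H; congr exist; exact: Prop_irrelevance.
(* A nonempty chain is bounded by its union; the empty one needs a separate bound, namely the graph
   of the inverse of [f]. *)
- have [[G CG]|C0] := pselect (exists G, C G); last first.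
    by exists (exist _ _ G0) => G CG; case: C0; exists G.
  have PU : partial_retraction (fun w v => exists2 H, C H & sval H w v).
    split=> [v|w v v' [H CH Hv] [H' CH' Hv']|c w w' v v' [H CH Hv] [H' CH' Hv']].
    + by exists G => //; case: (svalP G).
    + have [/asboolP HH|/asboolP HH] := totC _ _ CH CH'.
        by have [_ u _] := svalP H'; exact: u (HH _ _ Hv) Hv'.
      by have [_ u _] := svalP H; exact: u Hv (HH _ _ Hv').
    + have [/asboolP HH|/asboolP HH] := totC _ _ CH CH'.
        by exists H' => //; have [_ _ l] := svalP H'; apply: l => //; exact: HH.
      by exists H => //; have [_ _ l] := svalP H; apply: l => //; exact: HH.
  by exists (exist _ _ PU) => H CH; apply/asboolP => w v Hv /=; exists H.
have [Gf Gu Gl] := PG.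
have G00 : G 0 0 by rewrite -f0; exact: Gf.
have dom w : exists v, G w v.
  apply: contrapT => nw.
  (* If w lies outside the domain, the graph is extended along the line of w by sending w to 0. *)
  pose H x v := exists c, exists2 y, x = c *: w + y & G y v.
  (* A nonzero c would give w = c^-1 (y' - y), putting w in the domain; this makes [H]
     single-valued. *)
  have nz c y y' v v' : G y v -> G y' v' -> c *: w + y = y' -> c = 0.
    move=> Gy Gy' E; apply: contrapT => /eqP c0; apply: nw.
    exists (c^-1 *: (- 1 *: v + v')).
    have -> : w = c^-1 *: (- 1 *: y + y') + 0.
      by rewrite -E scaleN1r [c *: w + y]addrC addKr scalerA mulVf ?scale1r ?addr0.
    by rewrite -[X in G _ X]addr0; apply: (Gl) => //; apply: (Gl).
  have PH : partial_retraction H.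
    split=> [v|x v v' [c [y -> Gy]] [c' [y' E Gy']]|
             c x x' v v' [d [y -> Gy]] [d' [y' -> Gy']]].
    + by exists 0; exists (f v) => //; rewrite scale0r add0r.
    + have cc : c - c' = 0.
        apply: (nz _ y y' v v') => //.
        by rewrite scalerBl addrAC E addrAC subrr add0r.
      move: E; rewrite (subr0_eq cc) => /addrI E; by apply: Gu Gy _; rewrite E.
    + exists (c * d + d'), (c *: y + y'); last exact: Gl.
      by rewrite scalerDr scalerA scalerDl addrACA.
  have GH : R (exist _ G PG) (exist _ H PH).
    by apply/asboolP => x v Gx; exists 0, x => //; rewrite scale0r add0r.
  have /(congr1 sval) /= E := Gmax _ GH; apply: nw; exists 0; rewrite -E.
  by exists 1, 0 => //; rewrite scale1r addr0.
have [p pP] := choice dom; exists p => [c x y|v].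
  by apply: Gu (pP _) _; apply: (Gl).
by apply: Gu (pP _) _.
Qed.

End Retraction.

Section InducedCovariance.
Variables (K : fieldType) (A : hopfType K) (X : algType K).
Variables (iota : {lrmorphism X -> A}) (Gam : fodc A).

(** The coaction must take values in the tensor product with the induced calculus itself. Applying a
    retraction [p] in the second factor provides this without choosing preimages. *)
Lemma induced_left_covariant (Phi : {linear Gam -> tensor A Gam}) :
  left_coideal iota -> left_coaction (idfun : {lrmorphism A -> A}) Phi ->
  left_covariant iota (induced_fodc iota Gam).
Proof.
move=> coid cPhi; split=> //.
pose i := (\val : induced_car iota Gam -> Gam).
have li : linear i by move=> c g h; rewrite /i linearP.
have [p lp ip] := linear_retraction li val_inj.
have lid : linear (@idfun A) by [].
have lPhi : linear (fun g => tmap id p (Phi (i g))).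
  by move=> c g h; rewrite li linearP (tmap_linear lid lp).
pose F := GRing.isLinear.Build K (induced_car iota Gam)
  (tensor A (induced_car iota Gam)) _ _ lPhi.
exists (HB.pack_for
  {linear induced_fodc iota Gam -> tensor A (induced_fodc iota Gam)}
  (fun g => tmap id p (Phi (i g))) F).
move=> x y tx ty Hx Hy /=.
have E a (t : tensor A A) : comul a = t ->
    tmap id (idfun : {lrmorphism A -> A}) t = comul a.
  move=> ->; move: t; apply: tensor_ext => //; first exact: tmap_linear.
  by move=> v w; rewrite tmap_pure.
rewrite (cPhi (iota x) (iota y) (tmap id iota tx) (tmap id iota ty)); last 2 first.
- by apply: E.
- by apply: E.
have li_iota : linear iota by exact: linearP.
have ld : linear (diff Gam) by exact: linearP.
have ldi : linear (diff (induced_fodc iota Gam)) by exact: linearP.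
have [G1 G2] := tmul_bilinear (mul_bilinear A) (lact_bilinear Gam).
have [I1 I2] := tmul_bilinear (mul_bilinear A)
  (lact_bilinear (induced_fodc iota Gam)).
(* Both sides are bilinear in Delta x and Delta y, so pure tensors suffice; there the second factor
   z dw already lies in the induced calculus and [p] recovers it. *)
move: tx {Hx}; apply: tensor_ext => [c s t|c s t|a z].
- by rewrite (tmap_linear lid li_iota) G1 (tmap_linear lid lp).
- by rewrite I1.
move: ty {Hy}; apply: tensor_ext => [c s t|c s t|b w].
- by rewrite !(tmap_linear lid) // G2 (tmap_linear lid lp).
- by rewrite (tmap_linear lid) // I2.
rewrite !tmap_pure // tmul_pure // ?tmap_pure // ?tmul_pure //.
- by rewrite -(ip (induced_lact z (induced_d iota Gam w))).
- exact: lact_bilinear (induced_fodc iota Gam).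
- exact: lact_bilinear Gam.
Qed.

End InducedCovariance.

Section SubalgebraCoideal.
Variables (K : fieldType) (A : hopfType K) (n : nat) (u : 'M[A]_n.+1).
Hypothesis cu : corep u.

(** The x_i and the y_i are the last columns of u and of its contragredient, so the right tensor
    factors of their coproducts are again generators. *)
Lemma Zalg_left_coideal : left_coideal (Zincl u).
Proof.
have lid : linear (@idfun A) by [].
have li : linear (Zincl u) by exact: linearP.
have lt := tmap_linear lid li.
have mA := mul_bilinear A; have mZ := mul_bilinear (Zalg u).
have [M1 M2] := tmul_bilinear mA mA; have [Z1 Z2] := tmul_bilinear mA mZ.
move=> x; have := subalg_valP x; rewrite -[subalg_val x]/(Zincl u x).
move: (Zincl u x) => a /asboolP; 
elim=> {x a} [a [i [->|->]]||c a b _ [s Hs] _ [t Ht]|a b _ [s Hs] _ [t Ht]].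
- exists (\sum_k u i k ⊗ Zx u k); rewrite (lin_sum _ _ _ lt) cu.1.
  by apply: eq_bigr => k _; rewrite tmap_pure.
- exists (\sum_k antipode (u k i) ⊗ Zy u k); rewrite (lin_sum _ _ _ lt).
  rewrite -contraE (corep_contragredient cu).1.
  by apply: eq_bigr => k _; rewrite tmap_pure // !contraE.
- by exists (1 ⊗ 1); rewrite tmap_pure // comul1.
- by exists (c *: s + t); rewrite lt Hs Ht linearP.
- exists (tmul (fun v w : A => v * w) (fun v w : Zalg u => v * w) s t).
  rewrite comulM -Hs -Ht.
  move: s {Hs}; apply: tensor_ext => [c s s'|c s s'|v w]; rewrite ?Z1 ?lt ?M1 //.
  move: t {Ht}; apply: tensor_ext => [c s s'|c s s'|v' w']; rewrite ?Z2 ?lt ?M2 //.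
  by rewrite tmul_pure // !tmap_pure // tmul_pure // rmorphM.
Qed.

End SubalgebraCoideal.

Theorem proposition5 (R : realType) (n : nat) (q : R[i])
    (q_neq0 : q != 0) (q_neq1 : q != 1) (q_neqN1 : q != -1)
    (A : hopfType R[i]) (u : 'M[A]_n.+1) (OA : is_OGLq q u)
    (r rbar : {scalar tensor A A}) (r_univ : universal_rform r rbar)
    (r_u : forall i j k l, r (u i j ⊗ u k l) = Rhat q k i j l)
    (Gam : fodc A) (Gam_bi : is_Gamma_bi u r rbar Gam) :
  let d := diff (GammaZ u Gam) in
  let x := Zx u in
  let y := Zy u in
  let Rgrave i j k m := r (antipode (antipode (u k j)) ⊗ u i m) in
  let omegaNN := omega Gam (u ord_max ord_max) in
  left_covariant (Zincl u) (GammaZ u Gam)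
  /\ (forall i j,
        [/\ d (x i) <* x j
             = q *: \sum_k \sum_m Rhat q i j k m *: (x k *> d (x m)),
            d (y i) <* y j
             = q^-1 *: \sum_k \sum_m Rhat_inv q j i m k *: (y k *> d (y m)),
            d (x i) <* y j
             = q^-1 *: \sum_k \sum_m Rhat_inv q k i m j *: (y k *> d (x m)) &
            d (y i) <* x j
             = q *: \sum_k \sum_m Rgrave i j k m *: (x k *> d (y m))])
  /\ (forall i,
        omegaNN <* u i ord_max = q ^+ 2 *: (u i ord_max *> omegaNN)
        /\ omegaNN <* antipode (u ord_max i)
           = q ^- 2 *: (antipode (u ord_max i) *> omegaNN)).
Proof.
move=> d x y Rgrave omegaNN.
have [[rtt _ _] du eu] := OA; have cu : corep u by [].
have [[Phi cPhi _] _ comm] := Gam_bi.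
have valE c (F : 'I_n.+1 -> 'I_n.+1 -> GammaZ u Gam) :
    \val (c *: \sum_k \sum_m F k m) = c *: \sum_k \sum_m \val (F k m) :> Gam.
  rewrite linearZ raddf_sum; congr (_ *: _); apply: eq_bigr => k _.
  exact: raddf_sum.
split; first exact: induced_left_covariant (Zalg_left_coideal cu) cPhi.
split=> [i j|i]; last first.
  split.
    rewrite /omegaNN (omega_x cu r_univ r_u comm).
    rewrite (sum_only (i0 := ord_max)) => [|a aN]; last first.
      by rewrite big1 // => s _; rewrite Rhat_lastl (negbTE aN) andbF scale0r.
    rewrite (sum_only (i0 := ord_max)) => [|s sN]; last first.
      by rewrite Rhat_lastl (negbTE sN) scale0r.
    by rewrite Rhat_lastl !eqxx scalerA.
  rewrite /omegaNN (omega_y q_neq0 cu r_univ r_u comm).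
  rewrite (sum_only (i0 := ord_max)) => [|a aN]; last first.
    rewrite big1 // => s _.
    by rewrite Rbar_lastr (eq_sym ord_max a) (negbTE aN) scale0r.
  rewrite (sum_only (i0 := ord_max)) => [|s sN]; last first.
    by rewrite Rbar_lastr (negbTE sN) andbF scale0r.
  by rewrite Rbar_lastr !eqxx scalerA -invfM.
(* The induced calculus embeds in the calculus over [A], so the four relations may be checked
   there. *)
split; apply: val_inj; rewrite valE /=.
- exact: (diff_x_mul_x cu r_univ r_u comm rtt).
- rewrite (diff_y_mul_y q_neq0 cu r_univ r_u comm); congr (_ *: _).
  by apply: eq_bigr => k _; apply: eq_bigr => m _; rewrite Rhat_invE.
- rewrite (diff_x_mul_y q_neq0 cu r_univ r_u comm); congr (_ *: _).
  by apply: eq_bigr => k _; apply: eq_bigr => m _; rewrite Rhat_invE.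
- exact: (diff_y_mul_x q_neq0 cu r_univ r_u comm).
Qed.
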